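(* Let $K$ be a field, let $R$ be a Frobenius $K$-algebra, let $n\geq 2$ be an integer, and let $\varphi:(R^* )^{\otimes_R n}\to R$ be an associative morphism of $R$-bimodules. Then: (i) If $R$ is a local algebra, then $A(R,R^*,\varphi)$ is a symmetric algebra if and only if either $(R^* )^{\otimes_R(n-2)}\simeq R$ as $R$-bimodules, or $\varphi$ is an isomorphism. (ii) $A(R,n)$ is a symmetric algebra if and only if $(R^* )^{\otimes_R(n-2)}\simeq R$ as $R$-bimodules.
   Context: All algebras, vector spaces and linear duals are over $K$; $R^*=\mathrm{Hom}_K(R,K)$ is an $R$-bimodule via $(r\rightharpoonup r^* )(s)=r^*(sr)$ and $(r^*\leftharpoonup r)(s)=r^*(rs)$. Convention: $M^{\otimes_R 0}=R$, $M^{\otimes_R 1}=M$. A finite-dimensional algebra $B$ is Frobenius if $B^*\simeq B$ as left $B$-modules, and symmetric if $B^*\simeq B$ as $B$-bimodules (so Frobenius algebras are finite-dimensional). For an $R$-bimodule $M$, a bimodule morphism $\varphi:M^{\otimes_R n}\to R$ is associative if $\varphi(m_1\otimes_R\cdots\otimes_R m_n)m_{n+1}=m_1\varphi(m_2\otimes_R\cdots\otimes_R m_{n+1})$ for all $m_1,\ldots,m_{n+1}\in M$. For associative $\varphi$, $A(R,M,\varphi)$ is the factor algebra of the tensor algebra $T_R(M)=\bigoplus_{i\geq 0}M^{\otimes_R i}$ by the two-sided ideal generated by all elements $m_1\otimes_R\cdots\otimes_R m_n-\varphi(m_1\otimes_R\cdots\otimes_R m_n)$. It is identified with $R\oplus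 M\oplus\cdots\oplus M^{\otimes_R(n-1)}$, where the multiplication is tensor concatenation if the total length is less than $n$, and otherwise concatenation followed by applying $\varphi$ to $n$ successive tensor positions (the choice is irrelevant by associativity). $A(R,n)$ denotes $A(R,R^*,\varphi)$ in the case where $\varphi:(R^* )^{\otimes_R n}\to R$ is the zero morphism. *)

(* Defs.v *)
From HB Require Import structures.
From mathcomp Require Import all_boot all_algebra.
From mathcomp Require Import generic_quotient ring_quotient.
From mathcomp Require Import boolp classical_sets functions.
From mathcomp.multinomials Require Import freeg.

Set Implicit Arguments.
Unset Strict Implicit.
Unset Printing Implicit Defensive.

Import GRing.Theory.
Local Open Scope ring_scope.

(* Associative unital K-algebras, the zero algebra included.  MathComp's algType
   requires 1 != 0, which is not available for a quotient by an arbitrary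
   two-sided ideal, and the library hierarchy admits no new structure over both
   lmodType and pzRingType; hence the multiplication is a mixin over lmodType,
   and the ring structure is derived from it. *)
HB.mixin Record Lmodule_isKAlgebra (K : fieldType) A of GRing.Lmodule K A := {
  kone : A;
  kmul : A -> A -> A;
  kmulA : associative kmul;
  kmul1l : left_id kone kmul;
  kmul1r : right_id kone kmul;
  kmul_linear : forall x, linear (kmul x);
  kmul_linearl : forall y, linear (kmul^~ y)
}.

#[short(type="kalgType")]
HB.structure Definition KAlgebra (K : fieldType) :=
  {A of GRing.Lmodule K A & Lmodule_isKAlgebra K A}.

Section KAlgebraRing.
Variables (K : fieldType) (A : kalgType K).

Fact kmulDl : left_distributive (@kmul K A) +%R.
Proof. by move=> x y z; have := kmul_linearl z 1 x y; rewrite !scale1r. Qed.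
Fact kmulDr : right_distributive (@kmul K A) +%R.
Proof. by move=> x y z; have := kmul_linear x 1 y z; rewrite !scale1r. Qed.

#[non_forgetful_inheritance]
HB.instance Definition _ := GRing.Zmodule_isPzRing.Build (KAlgebra.sort A)
  (@kmulA K A) (@kmul1l K A) (@kmul1r K A) kmulDl kmulDr.

Lemma kscalerAl (a : K) (x y : A) : a *: (x * y) = (a *: x) * y.
Proof.
have := kmul_linearl y a x 0; rewrite addr0 => h.
by rewrite [RHS]h -[kmul 0 y]/(0 * y) mul0r addr0.
Qed.

Lemma kscalerAr (a : K) (x y : A) : a *: (x * y) = x * (a *: y).
Proof.
have := kmul_linear x a y 0; rewrite addr0 => h.
by rewrite [RHS]h -[kmul x 0]/(x * 0) mulr0 addr0.
Qed.

End KAlgebraRing.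

(* R-bimodules over a K-algebra R: K-bilinear actions, so that the two induced
   K-actions both coincide with the given scaling. *)
HB.mixin Record Lmodule_isBimodule (K : fieldType) (R : kalgType K) M
    of GRing.Lmodule K M := {
  lact : R -> M -> M;
  ract : M -> R -> M;
  lact_linear : forall r, linear (lact r);
  lact_linearl : forall m, linear (lact^~ m);
  ract_linear : forall m, linear (ract m);
  ract_linearl : forall r, linear (ract^~ r);
  lact1 : forall m, lact 1 m = m;
  lactM : forall r s m, lact (r * s) m = lact r (lact s m);
  ract1 : forall m, ract m 1 = m;
  ractM : forall r s m, ract m (r * s) = ract (ract m r) s;
  lractA : forall r m s, ract (lact r m) s = lact r (ract m s)
}.

#[short(type="bimodType")]
HB.structure Definition Bimodule (K : fieldType) (R : kalgType K) :=
  {M of GRing.Lmodule K M & Lmodule_isBimodule K R M}.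

Section BimoduleMorphisms.
Variables (K : fieldType) (R : kalgType K) (M N : bimodType R).

Definition bimod_hom (f : M -> N) : Prop :=
  [/\ linear f, forall r m, f (lact r m) = lact r (f m)
    & forall m r, f (ract m r) = ract (f m) r].

Definition left_hom (f : M -> N) : Prop :=
  linear f /\ forall r m, f (lact r m) = lact r (f m).

Definition bimod_iso (f : M -> N) : Prop := bimod_hom f /\ bijective f.

Definition bimod_isomorphic : Prop := exists f : M -> N, bimod_iso f.

Definition left_isomorphic : Prop :=
  exists f : M -> N, left_hom f /\ bijective f.

End BimoduleMorphisms.

Arguments bimod_isomorphic {K R} M N.
Arguments left_isomorphic {K R} M N.

Definition regular (K : fieldType) (R : kalgType K) : Type := R.

Section Regular.
Variables (K : fieldType) (R : kalgType K).

HB.instance Definition _ := GRing.Lmodule.on (regular R).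

Let lactr (r : R) (m : regular R) : regular R := r * (m : R).
Let ractr (m : regular R) (r : R) : regular R := (m : R) * r.

Fact reg_lact_linear r : linear (lactr r).
Proof. by move=> a x y; rewrite /lactr mulrDr kscalerAr. Qed.
Fact reg_lact_linearl m : linear (lactr^~ m).
Proof. by move=> a x y; rewrite /lactr mulrDl kscalerAl. Qed.
Fact reg_ract_linear m : linear (ractr m).
Proof. by move=> a x y; rewrite /ractr mulrDr kscalerAr. Qed.
Fact reg_ract_linearl r : linear (ractr^~ r).
Proof. by move=> a x y; rewrite /ractr mulrDl kscalerAl. Qed.
Fact reg_lactM r s m : lactr (r * s) m = lactr r (lactr s m).
Proof. by rewrite /lactr mulrA. Qed.
Fact reg_ractM r s m : ractr m (r * s) = ractr (ractr m r) s.
Proof. by rewrite /ractr mulrA. Qed.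
Fact reg_lractA r m s : ractr (lactr r m) s = lactr r (ractr m s).
Proof. by rewrite /ractr /lactr mulrA. Qed.

HB.instance Definition _ := Lmodule_isBimodule.Build K R (regular R)
  reg_lact_linear reg_lact_linearl reg_ract_linear reg_ract_linearl
  (@mul1r R) reg_lactM (@mulr1 R) reg_ractM reg_lractA.

End Regular.

Section DualPred.
Variables (K : fieldType) (R : kalgType K).

Definition linear_form : {pred R -> K^o} := fun f => `[< linear f >].

Fact linear_form_submod : submod_closed linear_form.
Proof.
split=> [|a f g /asboolP fl /asboolP gl]; apply/asboolP => b x y.
  by rewrite /= scaler0 addr0.
rewrite !fctE/= fl gl !scalerDr addrACA; congr (_ + _ + _).
by rewrite !scalerA mulrC.
Qed.

HB.instance Definition _ :=
  GRing.isSubmodClosed.Build K (R -> K^o) linear_form linear_form_submod.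

Record dual : Type := Dual { dual_fun :> R -> K^o; _ : dual_fun \in linear_form }.

HB.instance Definition _ := [isSub for dual_fun].
HB.instance Definition _ := [Choice of dual by <:].
HB.instance Definition _ := [SubChoice_isSubLmodule of dual by <:].

Lemma dual_linear (f : dual) : linear f.
Proof. by case: f => f /= /asboolP. Qed.

Lemma dualP (f g : dual) : (forall x, f x = g x) -> f = g.
Proof. by move=> fg; apply/val_inj/funext. Qed.

Fact dual_lact_subproof (r : R) (f : dual) :
  (fun s => f (s * r)) \in linear_form.
Proof.
by apply/asboolP => a x y; rewrite mulrDl -kscalerAl dual_linear.
Qed.

Fact dual_ract_subproof (r : R) (f : dual) :
  (fun s => f (r * s)) \in linear_form.
Proof.
by apply/asboolP => a x y; rewrite mulrDr -kscalerAr dual_linear.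
Qed.

(* (r . f)(s) = f (s r) and (f . r)(s) = f (r s). *)
Definition dual_lact (r : R) (f : dual) : dual := Dual (dual_lact_subproof r f).
Definition dual_ract (f : dual) (r : R) : dual := Dual (dual_ract_subproof r f).

Fact dual_lact_linear r : linear (dual_lact r).
Proof. by move=> a f g; apply: dualP. Qed.
Fact dual_lact_linearl f : linear (dual_lact^~ f).
Proof.
by move=> a r s; apply: dualP => x /=; rewrite mulrDr -kscalerAr dual_linear.
Qed.
Fact dual_ract_linear f : linear (dual_ract f).
Proof.
by move=> a r s; apply: dualP => x /=; rewrite mulrDl -kscalerAl dual_linear.
Qed.
Fact dual_ract_linearl r : linear (dual_ract^~ r).
Proof. by move=> a f g; apply: dualP. Qed.
Fact dual_lact1 f : dual_lact 1 f = f.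
Proof. by apply: dualP => x /=; rewrite mulr1. Qed.
Fact dual_lactM r s f : dual_lact (r * s) f = dual_lact r (dual_lact s f).
Proof. by apply: dualP => x /=; rewrite mulrA. Qed.
Fact dual_ract1 f : dual_ract f 1 = f.
Proof. by apply: dualP => x /=; rewrite mul1r. Qed.
Fact dual_ractM r s f : dual_ract f (r * s) = dual_ract (dual_ract f r) s.
Proof. by apply: dualP => x /=; rewrite mulrA. Qed.
Fact dual_lractA r f s :
  dual_ract (dual_lact r f) s = dual_lact r (dual_ract f s).
Proof. by apply: dualP => x /=; rewrite mulrA. Qed.

HB.instance Definition _ := Lmodule_isBimodule.Build K R dual
  dual_lact_linear dual_lact_linearl dual_ract_linear dual_ract_linearl
  dual_lact1 dual_lactM dual_ract1 dual_ractM dual_lractA.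

End DualPred.

Section AlgebraPredicates.
Variables (K : fieldType) (B : kalgType K).

Definition finite_dimensional : Prop :=
  exists n (f : B -> 'rV[K]_n), linear f /\ bijective f.

Definition frobenius_algebra : Prop :=
  finite_dimensional /\ left_isomorphic (dual B) (regular B).

Definition symmetric_algebra : Prop :=
  finite_dimensional /\ bimod_isomorphic (dual B) (regular B).

Local Open Scope classical_set_scope.

Definition left_ideal (I : set B) : Prop :=
  [/\ I 0, forall x y, I x -> I y -> I (x + y) & forall r x, I x -> I (r * x)].

Definition maximal_left_ideal (I : set B) : Prop :=
  [/\ left_ideal I, I <> setT
    & forall J, left_ideal J -> I `<=` J -> J <> setT -> J = I].

Definition local_algebra : Prop := exists! I : set B, maximal_left_ideal I.

Definition two_sided_ideal (I : set B) : Prop :=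
  left_ideal I /\ forall r x, I x -> I (x * r).

Definition gen_ideal (S : set B) : set B :=
  [set x | forall I, two_sided_ideal I -> S `<=` I -> I x].

End AlgebraPredicates.

Arguments finite_dimensional {K} B.
Arguments frobenius_algebra {K} B.
Arguments symmetric_algebra {K} B.
Arguments local_algebra {K} B.

(* quomod S is V modulo the subspace generated by S. *)
Section QuotientModule.
Variables (K : fieldType) (V : lmodType K) (S : set V).
Local Open Scope classical_set_scope.
Local Open Scope quotient_scope.

Definition subspace (U : set V) : Prop :=
  U 0 /\ forall a x y, U x -> U y -> U (a *: x + y).

Definition spanned : {pred V} :=
  fun x => `[< forall U, subspace U -> S `<=` U -> U x >].

Lemma spanned_gen x : S x -> x \in spanned.
Proof. by move=> Sx; apply/asboolP => U _; apply. Qed.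

Lemma spanned_min (U : set V) :
  subspace U -> S `<=` U -> forall x, x \in spanned -> U x.
Proof. by move=> Us SU x /asboolP; apply. Qed.

Fact spanned_submod : submod_closed spanned.
Proof.
split=> [|a x y /asboolP xS /asboolP yS]; apply/asboolP => U Us SU.
  by case: Us.
by case: (Us) => _; apply; [apply: xS|apply: yS].
Qed.

HB.instance Definition _ :=
  GRing.isSubmodClosed.Build K V spanned spanned_submod.

Definition quomod : Type := Quotient.quot spanned.

HB.instance Definition _ := GRing.Zmodule.on quomod.
HB.instance Definition _ := EqQuotient.on quomod.

Definition quo (x : V) : quomod := \pi_quomod x.

Lemma quo_eqP x y : quo x = quo y <-> x - y \in spanned.
Proof.
rewrite /quo; split=> [e|]; last by rewrite Quotient.idealrBE => /eqP.
by rewrite Quotient.idealrBE; apply/eqP.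
Qed.

Lemma quo_surj (q : quomod) : exists x, q = quo x.
Proof. by exists (repr q); rewrite /quo reprK. Qed.

Lemma quoD x y : quo (x + y) = quo x + quo y.
Proof. by rewrite /quo -[\pi_quomod]/(\pi_(Quotient.quot spanned)) raddfD. Qed.

Definition quo_scale (a : K) (q : quomod) : quomod := quo (a *: repr q).

Lemma quo_scaleE a x : quo_scale a (quo x) = quo (a *: x).
Proof.
apply/quo_eqP; rewrite -scalerBr rpredZ //.
by apply/quo_eqP; rewrite /quo reprK.
Qed.

Fact quo_scaleA a b q : quo_scale a (quo_scale b q) = quo_scale (a * b) q.
Proof. by have [x ->] := quo_surj q; rewrite !quo_scaleE scalerA. Qed.
Fact quo_scale1 : left_id 1 quo_scale.
Proof. by move=> q; have [x ->] := quo_surj q; rewrite quo_scaleE scale1r. Qed.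
Fact quo_scaleDr : right_distributive quo_scale +%R.
Proof.
move=> a p q; have [x ->] := quo_surj p; have [y ->] := quo_surj q.
by rewrite -quoD !quo_scaleE scalerDr quoD.
Qed.
Fact quo_scaleDl q : {morph quo_scale^~ q : a b / a + b}.
Proof.
by move=> a b; have [x ->] := quo_surj q; rewrite !quo_scaleE scalerDl quoD.
Qed.

HB.instance Definition _ := GRing.Zmodule_isLmodule.Build K quomod
  quo_scaleA quo_scale1 quo_scaleDr quo_scaleDl.

Lemma quo_is_linear : linear quo.
Proof. by move=> a x y; rewrite quoD -quo_scaleE. Qed.

HB.instance Definition _ := GRing.isLinear.Build K V quomod *:%R quo quo_is_linear.

End QuotientModule.

Arguments quo {K V S} x.
Arguments quomod {K V} S.
Arguments spanned {K V} S.

Section LinearUtil.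
Variables (K : fieldType) (V W : lmodType K) (f : V -> W).
Hypothesis fl : linear f.

Lemma linD x y : f (x + y) = f x + f y.
Proof. by rewrite -[x in LHS]scale1r fl scale1r. Qed.
Lemma lin0 : f 0 = 0.
Proof. by apply: (addrI (f 0)); rewrite -linD !addr0. Qed.
Lemma linZ a x : f (a *: x) = a *: f x.
Proof. by rewrite -[a *: x]addr0 fl lin0 addr0. Qed.
Lemma linN x : f (- x) = - f x.
Proof. by rewrite -scaleN1r linZ scaleN1r. Qed.
Lemma linB x y : f (x - y) = f x - f y.
Proof. by rewrite linD linN. Qed.
Lemma lin_sum I r (P : pred I) (F : I -> V) :
  f (\sum_(i <- r | P i) F i) = \sum_(i <- r | P i) f (F i).
Proof. by apply: (big_morph f linD lin0). Qed.

End LinearUtil.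

Lemma fglift_linear (K : fieldType) (T : choiceType) (W : lmodType K)
  (f : T -> W) : linear (fglift f).
Proof.
have fD : {morph fglift f : x y / x + y >-> x + y}.
  by move=> x y; rewrite -[y in LHS]opprK lift_is_additive -[- y]add0r
    lift_is_additive -{1}(subrr (0 : {freeg T / K})) lift_is_additive
    subrr sub0r opprK.
move=> a x y; rewrite fD; congr (_ + _).
have f0 : fglift f 0 = 0.
  by rewrite -{1}(subrr (0 : {freeg T / K})) lift_is_additive subrr.
rewrite -[x]freeg_sumE scaler_sumr !(big_morph _ fD f0) scaler_sumr.
apply: eq_bigr => i _; set c := coeff i x.
have -> : a *: << c *g i >> = << a * c *g i >>.
  by apply/eqP/freeg_eqP => t; rewrite coeffZ !coeffU mulrA.
by rewrite !liftU scalerA.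
Qed.

(* M (x)_R N: the free vector space on M * N modulo the relations of
   K-bilinear R-balanced maps. *)
Section Tensor.
Variables (K : fieldType) (R : kalgType K) (M N : bimodType R).

Local Notation "[< m , n >]" :=
  (Freeg [:: (1 : K, (m : M, n : N))] : {freeg (M * N)%type / K}).

Inductive tens_rel : {freeg (M * N)%type / K} -> Prop :=
| TensRelL a m m' n :
    tens_rel ([< a *: m + m', n >] - (a *: [< m, n >] + [< m', n >]))
| TensRelR a m n n' :
    tens_rel ([< m, a *: n + n' >] - (a *: [< m, n >] + [< m, n' >]))
| TensRelB m r n : tens_rel ([< ract m r, n >] - [< m, lact r n >]).

Definition tens : Type := quomod tens_rel.

HB.instance Definition _ := GRing.Lmodule.on tens.

Definition tmk (m : M) (n : N) : tens := quo [< m, n >].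

Lemma tmk_linearl n : linear (tmk^~ n).
Proof.
move=> a m m'; rewrite -quo_is_linear; apply/quo_eqP.
exact/spanned_gen/TensRelL.
Qed.

Lemma tmk_linearr m : linear (tmk m).
Proof.
move=> a n n'; rewrite -quo_is_linear; apply/quo_eqP.
exact/spanned_gen/TensRelR.
Qed.

Lemma tmk_balanced m r n : tmk (ract m r) n = tmk m (lact r n).
Proof. exact/quo_eqP/spanned_gen/TensRelB. Qed.

Lemma tens_ind (P : tens -> Prop) :
    (forall m n, P (tmk m n)) -> (forall x y, P x -> P y -> P (x + y)) ->
  forall x, P x.
Proof.
move=> Pmk PD x; have P0 : P 0 by rewrite -(lin0 (tmk_linearl 0)).
have [y ->] := quo_surj x; rewrite -[y]freeg_sumE.
rewrite (lin_sum (@quo_is_linear _ _ _)).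
elim/big_rec: _ => // -[m n] z _; apply: PD.
set a := coeff _ _; suff -> : <<a *g (m, n)>> = a *: [< m, n >].
  by rewrite (linZ (@quo_is_linear _ _ _)) -(linZ (tmk_linearl n)).
by apply/eqP/freeg_eqP => t; rewrite coeffZ !coeffU mulrA mulr1.
Qed.

Section Lift.
Variables (P : lmodType K).

Lemma tens_eq_lin (f g : tens -> P) : linear f -> linear g ->
  (forall m n, f (tmk m n) = g (tmk m n)) -> f =1 g.
Proof.
move=> fl gl fg; apply: tens_ind => // x y fgx fgy.
by rewrite (linD fl) (linD gl) fgx fgy.
Qed.

Definition balanced (f : M -> N -> P) : Prop :=
  [/\ forall n, linear (f^~ n), forall m, linear (f m)
    & forall m r n, f (ract m r) n = f m (lact r n)].

Definition tens_lift (f : M -> N -> P) (x : tens) : P :=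
  fglift (fun p => f p.1 p.2) (repr x).

Variable f : M -> N -> P.
Hypothesis fb : balanced f.

Lemma tens_lift_quo x : tens_lift f (quo x) = fglift (fun p => f p.1 p.2) x.
Proof.
have Fl := fglift_linear (fun p : M * N => f p.1 p.2).
set F := fglift _ in Fl *; apply/eqP; rewrite -subr_eq0 -(linB Fl).
have : repr (quo x : tens) - x \in spanned tens_rel.
  by apply/quo_eqP; rewrite /quo reprK.
move: (_ - x); apply: (@spanned_min _ _ _ (fun z => F z == 0)).
  split=> [|a y z /eqP y0 /eqP z0]; first by rewrite (lin0 Fl).
  by rewrite Fl y0 z0 scaler0 addr0.
case: fb => fl fr fB _ [] *; rewrite [F _](linB Fl) ?[F (_ + _)]Fl /F.
all: rewrite !liftU !scale1r /=.
- by rewrite fl subrr.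
- by rewrite fr subrr.
- by rewrite fB subrr.
Qed.

Lemma tens_liftE m n : tens_lift f (tmk m n) = f m n.
Proof. by rewrite tens_lift_quo liftU scale1r. Qed.

Lemma tens_lift_linear : linear (tens_lift f).
Proof.
move=> a x y; have [u ->] := quo_surj x; have [v ->] := quo_surj y.
by rewrite -quo_is_linear !tens_lift_quo fglift_linear.
Qed.

End Lift.

Definition tens_lact (r : R) : tens -> tens :=
  tens_lift (fun m n => tmk (lact r m) n).
Definition tens_ract (x : tens) (r : R) : tens :=
  tens_lift (fun m n => tmk m (ract n r)) x.

Fact tens_lact_bal r : balanced (fun m n => tmk (lact r m) n).
Proof.
split=> [n a m m'|m a n n'|m s n]; rewrite ?lact_linear.
- exact: tmk_linearl.
- exact: tmk_linearr.
- by rewrite -lractA tmk_balanced.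
Qed.

Fact tens_ract_bal r : balanced (fun m n => tmk m (ract n r)).
Proof.
split=> [n a m m'|m a n n'|m s n]; rewrite ?ract_linearl.
- exact: tmk_linearl.
- exact: tmk_linearr.
- by rewrite tmk_balanced lractA.
Qed.

Lemma tens_lactE r m n : tens_lact r (tmk m n) = tmk (lact r m) n.
Proof. exact: (tens_liftE (tens_lact_bal r)). Qed.
Lemma tens_ractE r m n : tens_ract (tmk m n) r = tmk m (ract n r).
Proof. exact: (tens_liftE (tens_ract_bal r)). Qed.

Fact tens_lact_linear r : linear (tens_lact r).
Proof. exact: (tens_lift_linear (tens_lact_bal r)). Qed.
Fact tens_ract_linearl r : linear (tens_ract^~ r).
Proof. exact: (tens_lift_linear (tens_ract_bal r)). Qed.

Fact tens_lact_linearl x : linear (tens_lact^~ x).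
Proof.
move=> a r s; move: x; apply: tens_ind => [m n|x y ex ey].
  by rewrite !tens_lactE lact_linearl tmk_linearl.
by rewrite !(linD (tens_lact_linear _)) ex ey scalerDr addrACA.
Qed.
Fact tens_ract_linear x : linear (tens_ract x).
Proof.
move=> a r s; move: x; apply: tens_ind => [m n|x y ex ey].
  by rewrite !tens_ractE ract_linear tmk_linearr.
by rewrite !(linD (tens_ract_linearl _)) ex ey scalerDr addrACA.
Qed.
Fact tens_lact1 x : tens_lact 1 x = x.
Proof.
move: x; apply: tens_ind => [m n|x y ex ey]; first by rewrite tens_lactE lact1.
by rewrite (linD (tens_lact_linear _)) ex ey.
Qed.
Fact tens_ract1 x : tens_ract x 1 = x.
Proof.
move: x; apply: tens_ind => [m n|x y ex ey]; first by rewrite tens_ractE ract1.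
by rewrite (linD (tens_ract_linearl _)) ex ey.
Qed.
Fact tens_lactM r s x : tens_lact (r * s) x = tens_lact r (tens_lact s x).
Proof.
move: x; apply: tens_ind => [m n|x y ex ey].
  by rewrite !tens_lactE lactM.
by rewrite !(linD (tens_lact_linear _)) ex ey.
Qed.
Fact tens_ractM r s x : tens_ract x (r * s) = tens_ract (tens_ract x r) s.
Proof.
move: x; apply: tens_ind => [m n|x y ex ey].
  by rewrite !tens_ractE ractM.
by rewrite !(linD (tens_ract_linearl _)) ex ey.
Qed.
Fact tens_lractA r x s : tens_ract (tens_lact r x) s = tens_lact r (tens_ract x s).
Proof.
move: x; apply: tens_ind => [m n|x y ex ey].
  by rewrite tens_lactE !tens_ractE tens_lactE.
rewrite (linD (tens_lact_linear _)) !(linD (tens_ract_linearl _)).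
by rewrite (linD (tens_lact_linear _)) ex ey.
Qed.

HB.instance Definition _ := Lmodule_isBimodule.Build K R tens
  tens_lact_linear tens_lact_linearl tens_ract_linear tens_ract_linearl
  tens_lact1 tens_lactM tens_ract1 tens_ractM tens_lractA.

End Tensor.

Section TensorPowers.
Variables (K : fieldType) (R : kalgType K) (M : bimodType R).

Fixpoint tpow (n : nat) : bimodType R :=
  match n with
  | 0 => regular R
  | n1.+1 => match n1 with 0 => M | _.+1 => tens M (tpow n1) end
  end.

(* m 0 (x) m 1 (x) ... (x) m n.-1; only the first n values of m matter. *)
Fixpoint ptens (n : nat) (m : nat -> M) : tpow n :=
  match n with
  | 0 => (1 : R)
  | n1.+1 =>
      match n1 return tpow n1 -> tpow n1.+1 with
      | 0 => fun _ => m 0%N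
      | _.+1 => fun x => tmk (m 0%N) x
      end (ptens n1 (fun i => m i.+1))
  end.

(* m (x) y, with M (x)_R R identified with M. *)
Definition tcons (m : M) (j : nat) : tpow j -> tpow j.+1 :=
  match j with
  | 0 => fun r => ract m r
  | j'.+1 => fun y => tmk m y
  end.

Fixpoint concat (i : nat) : tpow i -> forall j, tpow j -> tpow (i + j)%N :=
  match i with
  | 0 => fun r j y => lact (r : R) y
  | i1.+1 =>
      match i1 return (tpow i1 -> forall j, tpow j -> tpow (i1 + j)%N) ->
                      tpow i1.+1 -> forall j, tpow j -> tpow (i1.+1 + j)%N with
      | 0 => fun _ m j y => tcons m y
      | i'.+1 => fun rec x j y => tens_lift (fun m x' => tmk m (rec x' j y)) x
      end (@concat i1)
  end.

End TensorPowers.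

Arguments tcons {K R M} m {j}.
Arguments concat {K R M i} x {j}.

Section ConcatTheory.
Variables (K : fieldType) (R : kalgType K) (M : bimodType R).
Local Notation T := (tpow M).

Lemma tcons_linearl j (y : T j) : linear (fun m : M => tcons m y).
Proof.
by case: j y => [|j] y a m m' /=; [apply: ract_linearl | apply: tmk_linearl].
Qed.

Lemma tcons_linear (m : M) j : linear (tcons m : T j -> T j.+1).
Proof. by case: j => [|j]; [apply: ract_linear | apply: tmk_linearr]. Qed.

Lemma tcons_balanced (m : M) r j (y : T j) :
  tcons (ract m r) y = tcons m (lact r y).
Proof. by case: j y => [|j] y /=; rewrite -?ractM ?tmk_balanced. Qed.

Lemma tcons_lact r (m : M) j (y : T j) : lact r (tcons m y) = tcons (lact r m) y.
Proof. by case: j y => [|j] y /=; rewrite ?lractA //; apply: tens_lactE. Qed.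

Fact concat_bal i j (y : T j) :
  (forall x : T i.+1, linear (concat x : T j -> T (i.+1 + j))) ->
  (forall y : T j, linear (fun x : T i.+1 => concat x y)) ->
  (forall r (x : T i.+1) (y : T j), concat (lact r x) y = lact r (concat x y)) ->
  balanced (fun m (x : T i.+1) => tmk m (concat x y) : T (i.+2 + j)).
Proof.
move=> lr ll lla; split=> [x|m a x x'|m r x]; first exact: tmk_linearl.
  by rewrite ll (tmk_linearr m).
by rewrite tmk_balanced lla.
Qed.

Lemma concat_spec i j :
  [/\ forall x : T i, linear (concat x : T j -> T (i + j)),
      forall y : T j, linear (fun x : T i => concat x y) &
      forall r (x : T i) (y : T j), concat (lact r x) y = lact r (concat x y)].
Proof.
elim: i => [|[|i] [IHr IHl IHa]].
- split=> [x|y|r x y] /=; first exact: lact_linear.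
  + exact: lact_linearl.
  + exact: lactM.
- split=> [x|y|r x y] /=; first exact: tcons_linear.
  + exact: tcons_linearl.
  + by rewrite tcons_lact.
have bal y := concat_bal y IHr IHl IHa.
have ll (y : T j) : linear (fun x : T i.+2 => concat x y).
  exact: (tens_lift_linear (bal y)).
have cE m (x : T i.+1) (y : T j) :
    concat (tmk m x : T i.+2) y = tmk m (concat x y) :> T (i.+2 + j).
  exact: (tens_liftE (bal y)).
split=> // [x a y y'|r x y].
  move: x; apply: tens_ind => [m x|x x' ex ex'].
    by rewrite !cE IHr (tmk_linearr m).
  by rewrite !(linD (ll _)) ex ex' scalerDr addrACA.
move: x; apply: (@tens_ind _ _ M (T i.+1)) => [m x|x x' ex ex'].
  rewrite cE [lact r (tmk m x)]tens_lactE cE.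
  by rewrite [RHS]tens_lactE.
by rewrite (linD (lact_linear r)) !(linD (ll _)) ex ex' (linD (lact_linear r)).
Qed.

Lemma concat_linear i (x : T i) j : linear (concat x : T j -> T (i + j)).
Proof. by case: (concat_spec i j). Qed.
Lemma concat_linearl i j (y : T j) : linear (fun x : T i => concat x y).
Proof. by case: (concat_spec i j). Qed.
Lemma concat_lact r i (x : T i) j (y : T j) :
  concat (lact r x) y = lact r (concat x y).
Proof. by case: (concat_spec i j). Qed.

Lemma concat_tmk m i (x : T i.+1) j (y : T j) :
  concat (tmk m x : T i.+2) y = tmk m (concat x y) :> T (i.+2 + j).
Proof.
case: (concat_spec i.+1 j) => IHr IHl IHa.
exact: (tens_liftE (concat_bal y IHr IHl IHa)).
Qed.

Lemma concat_tcons m i (x : T i) j (y : T j) :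
  concat (tcons m x) y = tcons m (concat x y) :> T (i.+1 + j).
Proof.
case: i x => [|i] x; first by rewrite /= tcons_balanced.
exact: concat_tmk.
Qed.

Definition tcast p q (e : p = q) (x : T p) : T q := eq_rect p T x q e.

Lemma tcast_linear p q (e : p = q) : linear (tcast e).
Proof. by case: q / e. Qed.

Lemma tcast_irr p q (e e' : p = q) x : tcast e x = tcast e' x.
Proof. by congr tcast; apply: eq_irrelevance. Qed.

Lemma tcast_id p (e : p = p) x : tcast e x = x.
Proof. by rewrite (tcast_irr e erefl). Qed.

Lemma tcast_tcons m p q (e : p = q) (e' : p.+1 = q.+1) (x : T p) :
  tcast e' (tcons m x) = tcons m (tcast e x).
Proof. by case: q / e e' => e'; rewrite tcast_id. Qed.

Lemma concatA i (x : T i) j (y : T j) k (z : T k) (e : (i + j + k = i + (j + k))%N) :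
  tcast e (concat (concat x y) z) = concat x (concat y z).
Proof.
elim: i x e => [|[|i] IH] x e.
- by rewrite tcast_id /= concat_lact.
- have e1 : (j + k = j + k)%N by [].
  rewrite [concat x y]/(tcons x y) concat_tcons.
  by rewrite (tcast_tcons _ e1 e) tcast_id.
move: x; apply: (@tens_ind _ _ M (T i.+1)) => [m x|x x' ex ex'].
  have e1 : (i.+1 + j + k = i.+1 + (j + k))%N by rewrite addnA.
  have eL : concat (concat (tcons m x) y) z =
      tcons m (concat (concat x y) z) :> T (i.+1 + j + k).+1.
    rewrite (concat_tcons m x y). exact: (concat_tcons m (concat x y) z).
  have eR : concat (tcons m x) (concat y z) =
      tcons m (concat x (concat y z)) :> T (i.+1 + (j + k)).+1.
    exact: (concat_tcons m x (concat y z)).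
  apply: etrans (congr1 (tcast e) eL) _; apply: etrans (esym eR).
  by rewrite -(IH x e1); apply: tcast_tcons.
by rewrite !(linD (concat_linearl _)) (linD (tcast_linear _)) ex ex'.
Qed.

Lemma concat1r i (x : T i) (e : (i + 0 = i)%N) :
  tcast e (concat x ((1 : R) : T 0) ) = x.
Proof.
elim: i x e => [|[|i] IH] x e; rewrite ?tcast_id.
- exact: mulr1.
- exact: ract1.
move: x; apply: (@tens_ind _ _ M (T i.+1)) => [m x|x x' ex ex'].
  have e1 : (i.+1 + 0 = i.+1)%N by rewrite addn0.
  apply: etrans (congr1 (tcast e) (concat_tcons m x ((1 : R) : T 0))) _.
  by rewrite -[in RHS](IH x e1); apply: tcast_tcons.
by rewrite (linD (concat_linearl _)) (linD (tcast_linear _)) ex ex'.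
Qed.

End ConcatTheory.

Section DirectProduct.
Variables (K : fieldType) (T : nat -> lmodType K).

Definition dprod : Type := forall i, T i.

HB.instance Definition _ := gen_eqMixin dprod.
HB.instance Definition _ := gen_choiceMixin dprod.

Lemma dprodP (f g : dprod) : (forall i, f i = g i) -> f = g.
Proof. exact: functional_extensionality_dep. Qed.

Let zero : dprod := fun=> 0.
Let opp (f : dprod) : dprod := fun i => - f i.
Let add (f g : dprod) : dprod := fun i => f i + g i.
Let scale (a : K) (f : dprod) : dprod := fun i => a *: f i.

Fact dprod_addA : associative add.
Proof. by move=> f g h; apply: dprodP => i; apply: addrA. Qed.
Fact dprod_addC : commutative add.
Proof. by move=> f g; apply: dprodP => i; apply: addrC. Qed.
Fact dprod_add0 : left_id zero add.
Proof. by move=> f; apply: dprodP => i; apply: add0r. Qed.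
Fact dprod_addN : left_inverse zero opp add.
Proof. by move=> f; apply: dprodP => i; apply: addNr. Qed.

HB.instance Definition _ := GRing.isZmodule.Build dprod
  dprod_addA dprod_addC dprod_add0 dprod_addN.

Fact dprod_scaleA a b f : scale a (scale b f) = scale (a * b) f.
Proof. by apply: dprodP => i; apply: scalerA. Qed.
Fact dprod_scale1 : left_id 1 scale.
Proof. by move=> f; apply: dprodP => i; apply: scale1r. Qed.
Fact dprod_scaleDr : right_distributive scale +%R.
Proof. by move=> a f g; apply: dprodP => i; apply: scalerDr. Qed.
Fact dprod_scaleDl f : {morph scale^~ f : a b / a + b}.
Proof. by move=> a b; apply: dprodP => i; apply: scalerDl. Qed.

HB.instance Definition _ := GRing.Zmodule_isLmodule.Build K dprod
  dprod_scaleA dprod_scale1 dprod_scaleDr dprod_scaleDl.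

End DirectProduct.

(* T_R(M), as the finitely supported sequences (x_i)_i, x_i in M^{(x) i}. *)
Section TensorAlgebra.
Variables (K : fieldType) (R : kalgType K) (M : bimodType R).
Local Notation T := (tpow M).
Local Notation P := (dprod T).

Definition fin_supp : {pred P} :=
  fun f => `[< exists N, forall i, (N <= i)%N -> f i = 0 >].

Fact fin_supp_submod : submod_closed fin_supp.
Proof.
split=> [|a f g /asboolP[N fN] /asboolP[N' gN']]; apply/asboolP.
  by exists 0%N.
exists (maxn N N') => i; rewrite geq_max => /andP[Ni N'i].
rewrite -[LHS]/(a *: f i + g i).
by rewrite fN // gN' // scaler0 addr0.
Qed.

HB.instance Definition _ :=
  GRing.isSubmodClosed.Build K P fin_supp fin_supp_submod.

Record talg : Type := TAlg { talg_fun : P; _ : talg_fun \in fin_supp }.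

HB.instance Definition _ := [isSub for talg_fun].
HB.instance Definition _ := [Choice of talg by <:].
HB.instance Definition _ := [SubChoice_isSubLmodule of talg by <:].

Definition talg_coef (f : talg) (i : nat) : T i := talg_fun f i.
Coercion talg_coef : talg >-> Funclass.

Lemma talg_supp (f : talg) : exists N, forall i, (N <= i)%N -> f i = 0.
Proof. by case: f => f /= /asboolP. Qed.

Lemma talgP (f g : talg) : (forall i, f i = g i) -> f = g.
Proof. by move=> fg; apply/val_inj/dprodP. Qed.

(* The sequence with x in degree p and 0 elsewhere. *)
Definition inj (p : nat) (x : T p) : P :=
  fun k => match p =P k with ReflectT e => tcast e x | ReflectF _ => 0 end.

Lemma inj_linear p k : linear (fun x : T p => inj x k).
Proof.
move=> a x y; rewrite /inj; case: eqP => [e|_]; first exact: tcast_linear.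
by rewrite scaler0 addr0.
Qed.

Lemma inj_eq p (x : T p) : inj x p = x.
Proof. by rewrite /inj; case: eqP => // e; apply: tcast_id. Qed.

Lemma inj_neq p (x : T p) k : p != k -> inj x k = 0.
Proof. by rewrite /inj; case: eqP. Qed.

Lemma inj_cast p q (e : p = q) (x : T p) : inj (tcast e x) = inj x.
Proof. by case: q / e. Qed.

Lemma inj_supp p (x : T p) : inj x \in fin_supp.
Proof.
by apply/asboolP; exists p.+1 => i pi; rewrite inj_neq // ltn_eqF.
Qed.

Definition hom_elt (p : nat) (x : T p) : talg := TAlg (inj_supp x).

(* (f g)_k is the sum of the f_i (x) g_j over i + j = k. *)
Definition cauchy (f g : P) : P := fun k =>
  \sum_(i < k.+1) \sum_(j < k.+1) inj (concat (f i) (g j)) k.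

Lemma concat_inj_suml N (p c : nat) (u : T p) (z : T c) k : (k < N)%N ->
  \sum_(a < N) inj (concat (inj u a) z) k = inj (concat u z) k.
Proof.
move=> kN; have [pN|Np] := ltnP p N.
  rewrite (bigD1 (Ordinal pN)) //= inj_eq big1 ?addr0 // => a ap.
  rewrite (@inj_neq _ u) ?(lin0 (concat_linearl z)) ?(lin0 (inj_linear k)) //.
  by rewrite eq_sym; exact: ap.
rewrite big1 => [|a _].
  by rewrite inj_neq // gtn_eqF // (leq_trans kN) // (leq_trans Np) ?leq_addr.
rewrite (@inj_neq _ u) ?(lin0 (concat_linearl z)) ?(lin0 (inj_linear k)) //.
by rewrite gtn_eqF // (leq_trans _ Np).
Qed.

Lemma concat_inj_sumr N (p c : nat) (u : T p) (z : T c) k : (k < N)%N ->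
  \sum_(a < N) inj (concat z (inj u a)) k = inj (concat z u) k.
Proof.
move=> kN; have [pN|Np] := ltnP p N.
  rewrite (bigD1 (Ordinal pN)) //= inj_eq big1 ?addr0 // => a ap.
  rewrite (@inj_neq _ u) ?(lin0 (concat_linear z (j := _))) ?(lin0 (inj_linear k)) //.
  by rewrite eq_sym; exact: ap.
rewrite big1 => [|a _].
  by rewrite inj_neq // gtn_eqF // (leq_trans kN) // (leq_trans Np) ?leq_addl.
rewrite (@inj_neq _ u) ?(lin0 (concat_linear z (j := _))) ?(lin0 (inj_linear k)) //.
by rewrite gtn_eqF // (leq_trans _ Np).
Qed.

Lemma cauchyE N f g k : (k < N)%N ->
  cauchy f g k = \sum_(i < N) \sum_(j < N) inj (concat (f i) (g j)) k.
Proof.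
move=> kN; have big0 (i j : nat) : (k < i)%N || (k < j)%N ->
    inj (concat (f i) (g j)) k = 0.
  move=> kij; apply: inj_neq; rewrite gtn_eqF //.
  by case/orP: kij => /leq_trans-> //; rewrite ?leq_addr ?leq_addl.
have w (F : nat -> T k) : (forall i, (k < i)%N -> F i = 0) ->
    \sum_(i < N) F i = \sum_(i < k.+1) F i.
  move=> F0; rewrite -!(big_mkord xpredT) (big_cat_nat (leq0n k.+1) kN) //= addrC.
  by rewrite big_nat big1 ?add0r // => i /andP[/F0].
rewrite (w (fun i => \sum_(j < N) inj (concat (f i) (g j)) k)); last first.
  by move=> i ki; rewrite big1 // => j _; rewrite big0 ?ki.
apply: eq_bigr => i _; rewrite (w (fun j => inj (concat (f i) (g j)) k)) //.
by move=> j kj; rewrite big0 ?kj ?orbT.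
Qed.

Fact cauchy_linear f : linear (cauchy f).
Proof.
move=> a g h; apply: dprodP => k.
rewrite -[RHS]/(a *: cauchy f g k + cauchy f h k) /cauchy scaler_sumr.
rewrite -big_split; apply: eq_bigr => i _ /=.
rewrite scaler_sumr -big_split; apply: eq_bigr => j _ /=.
by rewrite -[(a *: g + h) j]/(a *: g j + h j) concat_linear inj_linear.
Qed.

Fact cauchy_linearl g : linear (cauchy^~ g).
Proof.
move=> a f h; apply: dprodP => k.
rewrite -[RHS]/(a *: cauchy f g k + cauchy h g k) /cauchy scaler_sumr.
rewrite -big_split; apply: eq_bigr => i _ /=.
rewrite scaler_sumr -big_split; apply: eq_bigr => j _ /=.
by rewrite -[(a *: f + h) i]/(a *: f i + h i) concat_linearl inj_linear.
Qed.

Fact cauchyA : associative cauchy.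
Proof.
move=> f g h; apply: dprodP => k.
pose S := \sum_(i < k.+1) \sum_(j < k.+1) \sum_(c < k.+1)
  inj (concat (f i) (concat (g j) (h c))) k.
transitivity S; rewrite [cauchy _ _ k]/cauchy /S.
  apply: eq_bigr => i _.
  have E (a : 'I_k.+1) : inj (concat (f i) (cauchy g h a)) k =
      \sum_(j < k.+1) \sum_(c < k.+1)
        inj (concat (f i) (inj (concat (g j) (h c)) a)) k.
    rewrite (cauchyE _ _ (ltn_ord a)) (lin_sum (concat_linear (f i) (j := a))).
    rewrite (lin_sum (inj_linear k)); apply: eq_bigr => j _.
    by rewrite (lin_sum (concat_linear (f i) (j := a))) (lin_sum (inj_linear k)).
  rewrite (eq_bigr _ (fun a _ => E a)) exchange_big; apply: eq_bigr => j _.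
  rewrite exchange_big; apply: eq_bigr => c _.
  exact: concat_inj_sumr.
symmetry.
have E (a c : 'I_k.+1) : inj (concat (cauchy f g a) (h c)) k =
    \sum_(i < k.+1) \sum_(j < k.+1)
      inj (concat (inj (concat (f i) (g j)) a) (h c)) k.
  rewrite (cauchyE _ _ (ltn_ord a)) (lin_sum (concat_linearl (h c))).
  rewrite (lin_sum (inj_linear k)); apply: eq_bigr => j _.
  by rewrite (lin_sum (concat_linearl (h c))) (lin_sum (inj_linear k)).
under eq_bigr => a _ do under eq_bigr => c _ do rewrite E.
under eq_bigr => a _ do rewrite exchange_big.
rewrite exchange_big; apply: eq_bigr => i _.
under eq_bigr => a _ do rewrite exchange_big.
rewrite exchange_big; apply: eq_bigr => j _.
rewrite exchange_big; apply: eq_bigr => c _.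
rewrite concat_inj_suml // -(concatA _ _ _ (esym (addnA _ _ _))).
by rewrite inj_cast.
Qed.

Fact cauchy1l f : cauchy (inj ((1 : R) : T 0)) f = f.
Proof.
apply: dprodP => k; rewrite /cauchy exchange_big.
under eq_bigr => j _ do rewrite concat_inj_suml // [concat _ _]lact1.
rewrite (bigD1 ord_max) //= inj_eq big1 ?addr0 // => j jk.
by rewrite inj_neq.
Qed.

Fact cauchy1r f : cauchy f (inj ((1 : R) : T 0)) = f.
Proof.
apply: dprodP => k; rewrite /cauchy.
under eq_bigr => j _ do
  rewrite concat_inj_sumr // -(inj_cast (addn0 j)) concat1r.
rewrite (bigD1 ord_max) //= inj_eq big1 ?addr0 // => j jk.
by rewrite inj_neq.
Qed.

Fact cauchy_supp (f g : talg) : cauchy (talg_fun f) (talg_fun g) \in fin_supp.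
Proof.
have [N fN] := talg_supp f; have [N' gN'] := talg_supp g.
apply/asboolP; exists (N + N')%N => k Nk; rewrite /cauchy big1 // => i _.
rewrite big1 // => j _; have [iN|Ni] := ltnP i N; last first.
  rewrite [talg_fun f i]fN //.
  by rewrite (lin0 (concat_linearl _)) (lin0 (inj_linear k)).
have [jN|N'j] := ltnP j N'; last first.
  rewrite [talg_fun g j]gN' //.
  by rewrite (lin0 (concat_linear _ (j := j))) (lin0 (inj_linear k)).
by rewrite inj_neq // ltn_eqF // (leq_trans _ Nk) // -addSn leq_add // ltnW.
Qed.

Definition talg_one : talg := hom_elt ((1 : R) : T 0).
Definition talg_mul (f g : talg) : talg := TAlg (cauchy_supp f g).

Fact talg_mulA : associative talg_mul.
Proof. by move=> f g h; apply/val_inj/cauchyA. Qed.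
Fact talg_mul1l : left_id talg_one talg_mul.
Proof. by move=> f; apply/val_inj/cauchy1l. Qed.
Fact talg_mul1r : right_id talg_one talg_mul.
Proof. by move=> f; apply/val_inj/cauchy1r. Qed.
Fact talg_mul_linear f : linear (talg_mul f).
Proof. by move=> a g h; apply/val_inj/cauchy_linear. Qed.
Fact talg_mul_linearl g : linear (talg_mul^~ g).
Proof. by move=> a f h; apply/val_inj/cauchy_linearl. Qed.

HB.instance Definition _ := Lmodule_isKAlgebra.Build K talg
  talg_mulA talg_mul1l talg_mul1r talg_mul_linear talg_mul_linearl.

End TensorAlgebra.

Section QuotientAlgebra.
Variables (K : fieldType) (B : kalgType K) (S : set B).
Local Open Scope classical_set_scope.

Definition quoalg : Type := quomod (gen_ideal S).

HB.instance Definition _ := GRing.Lmodule.on quoalg.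

Lemma gen_ideal_ideal : two_sided_ideal (gen_ideal S).
Proof.
split=> [|r x xI I Ii SI]; last by case: (Ii) => _; apply; apply: (xI I).
split=> [I [[]]//|x y xI yI I Ii SI|r x xI I Ii SI]; case: (Ii) => [[_ ID Il] _].
  by apply: ID; [apply: (xI I)|apply: (yI I)].
by apply: Il; apply: (xI I).
Qed.

Lemma spanned_gen_ideal x : x \in spanned (gen_ideal S) <-> gen_ideal S x.
Proof.
split=> [|xI]; last exact: spanned_gen.
apply: spanned_min => //; have [[I0 ID Il] Ir] := gen_ideal_ideal.
by split=> // a y z yI zI; apply: ID => //; rewrite -[y]mul1r kscalerAl; apply: Il.
Qed.

Definition quo_mul (p q : quoalg) : quoalg :=
  quo ((repr p : B) * (repr q : B)).

Lemma quo_mulE (x y : B) :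
  quo_mul (quo x : quoalg) (quo y : quoalg) = quo (x * y).
Proof.
have rep (z : B) : gen_ideal S ((repr (quo z : quoalg) : B) - z).
  by apply/spanned_gen_ideal/quo_eqP; rewrite /quo reprK.
have [[I0 ID Il] Ir] := gen_ideal_ideal.
apply/quo_eqP/spanned_gen_ideal; set x' := repr _; set y' := repr _.
have -> : x' * y' - x * y = (x' - x) * y' + x * (y' - y).
  by rewrite mulrBl mulrBr addrA subrK.
by apply: ID; [exact: Ir _ _ (rep x) | exact: Il _ _ (rep y)].
Qed.

Fact quo_mulA : associative quo_mul.
Proof.
move=> p q r; have [x ->] := quo_surj p; have [y ->] := quo_surj q.
by have [z ->] := quo_surj r; rewrite !quo_mulE mulrA.
Qed.
Fact quo_mul1l : left_id (quo (1 : B) : quoalg) quo_mul.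
Proof. by move=> p; have [x ->] := quo_surj p; rewrite quo_mulE mul1r. Qed.
Fact quo_mul1r : right_id (quo (1 : B) : quoalg) quo_mul.
Proof. by move=> p; have [x ->] := quo_surj p; rewrite quo_mulE mulr1. Qed.
Fact quo_mul_linear p : linear (quo_mul p).
Proof.
move=> a q r; have [x ->] := quo_surj p; have [y ->] := quo_surj q.
have [z ->] := quo_surj r.
by rewrite -quo_is_linear !quo_mulE mulrDr -kscalerAr quo_is_linear.
Qed.
Fact quo_mul_linearl r : linear (quo_mul^~ r).
Proof.
move=> a p q; have [x ->] := quo_surj p; have [y ->] := quo_surj q.
have [z ->] := quo_surj r.
by rewrite -quo_is_linear !quo_mulE mulrDl -kscalerAl quo_is_linear.
Qed.

HB.instance Definition _ := Lmodule_isKAlgebra.Build K quoalg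
  quo_mulA quo_mul1l quo_mul1r quo_mul_linear quo_mul_linearl.

End QuotientAlgebra.

Section FactorAlgebra.
Variables (K : fieldType) (R : kalgType K) (M : bimodType R) (n : nat).
Variable phi : tpow M n -> regular R.

(* phi (m_1 (x) ... (x) m_n) m_(n+1) = m_1 phi (m_2 (x) ... (x) m_(n+1)); only
   the first n + 1 values of m matter. *)
Definition associative_map : Prop :=
  forall m : nat -> M,
    lact (phi (ptens n m) : R) (m n)
    = ract (m 0%N) (phi (ptens n (fun i => m i.+1)) : R).

Definition phi_relations : set (talg M) :=
  [set t | exists m : nat -> M,
     t = hom_elt (ptens n m) - hom_elt (phi (ptens n m) : tpow M 0)].

(* The quotient of T_R(M) by the two-sided ideal generated by phi_relations;
   it makes sense for every map phi, associative or not. *)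
Definition factor_algebra : Type := quoalg phi_relations.

HB.instance Definition _ := KAlgebra.on factor_algebra.

End FactorAlgebra.

Definition zero_factor_algebra (K : fieldType) (R : kalgType K) (n : nat) :=
  factor_algebra (fun _ : tpow (dual R) n => 0 : regular R).

(* Main.v *)
Require Import Defs.
From mathcomp Require Import all_boot all_algebra.
From mathcomp Require Import boolp classical_sets.

Set Implicit Arguments.
Unset Strict Implicit.
Unset Printing Implicit Defensive.

Import GRing.Theory.
Local Open Scope ring_scope.

(** Write [D] for the dual bimodule of [R].  A Frobenius form [lam] generates
    [D] freely as a left module, and [lam r = nu(r) lam] for the Nakayama
    automorphism [nu], characterised by [lam(r s) = lam(s nu(r))].  Hence the
    tensor power [D^k] is free on [lam (x) ... (x) lam], with the right action
    twisted by [nu^k], and [A(R, D, phi)] is the quotient of the skew polynomial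
    ring [R[x; nu]] by [x^n = c], where [c = phi(lam (x) ... (x) lam)] satisfies
    [nu(c) = c] and [nu^n(r) c = c r] ([factor_algebra_skew]).  In these terms
    [phi] is an isomorphism iff [c] is a unit ([bimod_iso_modulusP]), and [D^k]
    is isomorphic to [R] iff some unit [w] satisfies [nu^k(s) w = w s] for all
    [s] ([tpow_regular_iso]).  A finite-dimensional algebra is symmetric iff it
    has a nondegenerate trace form ([nondegenerate_trace_symmetric],
    [symmetric_trace]).

    Sufficiency ([twisted_trace_symmetric]).  Given a unit [w] with
    [nu^(n-2)(s) w = w s], the form sending [sum_i a_i x^i] to
    [lam(a_(n-1) w)] is nondegenerate, each [a_i] being detected by multiples
    of [x^(n-1-i)].  If [c] is a unit, so is the form sending [sum_i a_i x^i]
    to [lam(a_1)].  Both are traces because [w] is automatically fixed by [nu]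
    ([intertwiner_fixed], [intertwiner_trace]).

    Necessity ([symmetric_intertwiner]).  Write a nondegenerate trace [t] on
    the top coefficient as [t(a x^(n-1)) = lam(a w)]; the trace property gives
    [nu^(n-2)(s) w = w s].  If [s w = 0] and [s c = 0], then [s x^(n-1)] lies in
    the radical of [t], so [s = 0].  For [phi = 0] this makes [w] a unit.  In
    general, duality over the Frobenius algebra [R] yields
    [w p + c q = 1] ([bezout_of_annihilator]), and in a local algebra one
    summand, hence [w] or [c], is a unit ([local_sum_unit]). *)

(** * Finite-dimensional linear algebra *)

Section FiniteDimension.
Variable K : fieldType.

Lemma inj_linear_rV_surj n (h : 'rV[K]_n -> 'rV[K]_n) :
  linear h -> (forall v, h v = 0 -> v = 0) -> forall w, exists v, h v = w.
Proof.
move=> hl h0 w; pose A := \matrix_i h (delta_mx 0 i).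
have hE v : v *m A = h v.
  rewrite {2}[v]row_sum_delta (lin_sum hl) mulmx_sum_row.
  by apply: eq_bigr => i _; rewrite (linZ hl) rowK.
have Afree : row_free A.
  by apply/inj_row_free => v; rewrite hE; apply: h0.
have Aunit : A \in unitmx by rewrite -row_free_unit.
by exists (w *m invmx A); rewrite -hE mulmxKV.
Qed.

Lemma linear_inverse (V W : lmodType K) (f : V -> W) (g : W -> V) :
  linear f -> cancel f g -> cancel g f -> linear g.
Proof. by move=> fl fg gf a x y; apply: (can_inj fg); rewrite fl !gf. Qed.

Lemma linear_injective (V W : lmodType K) (f : V -> W) :
  linear f -> (forall v, f v = 0 -> v = 0) -> injective f.
Proof.
move=> fl f0 x y fxy; apply/eqP; rewrite -subr_eq0; apply/eqP/f0.
by rewrite (linB fl) fxy subrr.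
Qed.

Lemma linear_comp (U V W : lmodType K) (f : V -> W) (g : U -> V) :
  linear f -> linear g -> linear (f \o g).
Proof. by move=> fl gl a x y /=; rewrite gl fl. Qed.

(** [h] is transported to an endomorphism of ['rV_n], where injectivity is
    invertibility of a matrix. *)
Lemma equidim_inj_surj n (V W : lmodType K) (f : V -> 'rV[K]_n)
    (g : W -> 'rV[K]_n) (h : V -> W) :
    linear f -> bijective f -> linear g -> bijective g ->
    linear h -> (forall v, h v = 0 -> v = 0) -> forall w, exists v, h v = w.
Proof.
move=> fl [f' fK f'K] gl [g' gK g'K] hl h0 w.
have f'l := linear_inverse fl fK f'K.
have [|u /eqP|v vE] := @inj_linear_rV_surj n (g \o h \o f') _ _ (g w).
- by do 2!apply: linear_comp => //.
- rewrite /= -[X in _ == X](lin0 gl) (can_eq gK) => /eqP/h0 u0.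
  by rewrite -[u]f'K u0 (lin0 fl).
by exists (f' v); apply: (can_inj gK).
Qed.

Lemma linear_form_of (B : kalgType K) (t : B -> K^o) :
  linear t -> t \in @linear_form K B.
Proof. by move=> tl; apply/asboolP. Qed.

(** The coordinates of a form are its values on the basis of [B] with
    coordinates [f]. *)
Lemma fd_dual (B : kalgType K) n (f : B -> 'rV[K]_n) :
  linear f -> bijective f ->
  exists g : dual B -> 'rV[K]_n, linear g /\ bijective g.
Proof.
move=> fl [f' fK f'K]; have f'l := linear_inverse fl fK f'K.
exists (fun p : dual B => \row_i (p (f' (delta_mx 0 i)) : K)); split.
  by move=> a p q; apply/rowP => i; rewrite !mxE.
pose t (v : 'rV[K]_n) : B -> K^o := fun b => \sum_i v 0 i * f b 0 i.
have tl v : linear (t v).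
  move=> a x y; rewrite /t scaler_sumr -big_split; apply: eq_bigr => i _ /=.
  by rewrite fl !mxE mulrDr mulrCA.
exists (fun v => Dual (linear_form_of (tl v))) => [p|v].
  apply: dualP => b /=; rewrite /t -[b in RHS]fK [f b in RHS]row_sum_delta.
  rewrite (lin_sum f'l) (lin_sum (dual_linear p)); apply: eq_bigr => i _.
  by rewrite mxE (linZ f'l) (linZ (dual_linear p)) mulrC.
apply/rowP => i; rewrite mxE /= /t (bigD1 i) //= f'K mxE !eqxx mulr1.
rewrite big1 ?addr0 // => j ji.
by rewrite mxE eqxx (negPf ji) mulr0.
Qed.

End FiniteDimension.

Section FiniteDimensionalAlgebra.
Variables (K : fieldType) (B : kalgType K).
Hypothesis B_fd : finite_dimensional B.

Lemma fd_inj_surj (h : B -> B) :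
  linear h -> (forall b, h b = 0 -> b = 0) -> forall w, exists v, h v = w.
Proof.
by have [n [f [fl fb]]] := B_fd; apply: (equidim_inj_surj fl fb fl fb).
Qed.

Lemma fd_dual_inj_surj (h : B -> dual B) :
  linear h -> (forall b, h b = 0 -> b = 0) -> forall p, exists v, h v = p.
Proof.
have [n [f [fl fb]]] := B_fd; have [g [gl gb]] := fd_dual fl fb.
exact: (equidim_inj_surj fl fb gl gb).
Qed.

Lemma dual_separates (b : B) : (forall p : dual B, p b = 0) -> b = 0.
Proof.
have [n [f [fl [f' fK f'K]]]] := B_fd => pb0.
rewrite -[b]fK; suff -> : f b = 0 by rewrite -(lin0 fl) fK.
apply/rowP => i; rewrite mxE.
have cl : linear (fun x => f x 0 i : K^o) by move=> a x y; rewrite fl !mxE.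
exact: (pb0 (Dual (linear_form_of cl))).
Qed.

Lemma rmul_linear (b : B) : linear (fun a : B => a * b : B).
Proof. exact: kmul_linearl. Qed.
Lemma lmul_linear (b : B) : linear (fun a : B => b * a : B).
Proof. exact: kmul_linear. Qed.

(** [x -> b x] is injective, hence surjective, so [b] also has a right
    inverse, which must be [a]. *)
Lemma fd_one_sided_inverse (a b : B) : a * b = 1 -> b * a = 1.
Proof.
move=> ab; have [x bx] : exists x, b * x = 1.
  apply: (fd_inj_surj (lmul_linear b)) => x bx0.
  by rewrite -[x]mul1r -ab -mulrA bx0 mulr0.
by rewrite -[a]mulr1 -{1}bx (mulrA a b) ab mul1r.
Qed.

Lemma fd_rreg_unit (w : B) : (forall s, s * w = 0 -> s = 0) ->
  exists v, w * v = 1 /\ v * w = 1.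
Proof.
move=> w0; have [v vw] := fd_inj_surj (rmul_linear w) w0 1.
by exists v; split=> //; apply: fd_one_sided_inverse.
Qed.

(** [b -> t(_ b)] is an injective bimodule map from [B] to its dual; equality of
    dimensions makes it bijective. *)
Lemma nondegenerate_trace_symmetric (t : B -> K^o) :
    linear t -> (forall a b, t (a * b) = t (b * a)) ->
    (forall a, (forall b, t (a * b) = 0) -> a = 0) ->
  symmetric_algebra B.
Proof.
move=> tl tC t0; split=> //.
pose h (b : B) : dual B := dual_lact b (Dual (linear_form_of tl)).
have hE b s : h b s = t (s * b) by [].
have hl : linear h by move=> a x y; apply: (dual_lact_linearl _ a x y).
have h0 b : h b = 0 -> b = 0.
  move=> hb; apply: t0 => s; rewrite tC -hE hb.
  by [].
have [g gK] := choice (fd_dual_inj_surj hl h0).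
have hK : cancel h g by move=> b; apply: (linear_injective hl h0); rewrite gK.
exists g; split; last by exists h.
split=> [|r m|m r]; first exact: linear_inverse hl hK gK.
- apply: (can_inj hK); rewrite gK -{1}[m]gK.
  by apply: dualP => s; rewrite [RHS]hE /= mulrA.
- apply: (can_inj hK); rewrite gK -{1}[m]gK.
  apply: dualP => s; rewrite [RHS]hE /=.
  by rewrite -mulrA tC (mulrA s).
Qed.

(** The trace is the form corresponding to [1]; left and right linearity of
    the isomorphism describe the form corresponding to [b] both as [t(_ b)] and
    as [t(b _)]. *)
Lemma symmetric_trace : symmetric_algebra B ->
  exists t : B -> K^o, [/\ linear t, forall a b, t (a * b) = t (b * a)
    & forall a, (forall b, t (b * a) = 0) -> a = 0].
Proof.
case=> _ [f [[fl fL fR] [g fK gK]]]; have gl := linear_inverse fl fK gK.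
pose t := g (1 : B).
have gL b : g b = dual_lact b t.
  by apply: (can_inj fK); rewrite gK [RHS]fL gK; apply/esym/mulr1.
have gR b : g b = dual_ract t b.
  by apply: (can_inj fK); rewrite gK [RHS]fR gK; apply/esym/mul1r.
exists t; split=> [|a b|a a0]; first exact: dual_linear.
  by rewrite -[t (a * b)]/(dual_lact b t a) -gL gR.
apply: (can_inj gK); rewrite (lin0 gl); apply: dualP => b.
by rewrite gL; apply: a0.
Qed.

End FiniteDimensionalAlgebra.

(** * Bimodules free of rank one on the left *)

Section TensorInduction.
Variables (K : fieldType) (R : kalgType K) (M : bimodType R).
Local Notation T := (tpow M).

Lemma tcons_ind k (P : T k.+1 -> Prop) :
    (forall m (y : T k), P (tcons m y)) ->
    (forall x y, P x -> P y -> P (x + y)) -> forall x, P x.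
Proof.
case: k P => [|k] P Pc PD x; last exact: (@tens_ind _ _ M (T k.+1)).
by rewrite -[x]ract1; apply: (Pc x ((1 : R) : T 0)).
Qed.

Lemma tcons_ract r (m : M) k (y : T k) :
  ract (tcons m y : T k.+1) r = tcons m (ract y r).
Proof. by case: k y => [|k] y /=; [rewrite -ractM | apply: tens_ractE]. Qed.

Lemma ptens_tcons k (m : nat -> M) :
  ptens k.+1 m = tcons (m 0%N) (ptens k (fun i => m i.+1)).
Proof. by case: k => [|k] //=; rewrite ract1. Qed.

End TensorInduction.

Section TwistedBimodule.
Variables (K : fieldType) (R : kalgType K) (M : bimodType R).

(** [psi] identifies [M] with [R] as a left module, [g] corresponding to [1],
    and the right action becomes [m r = m nu(r)]; the record determines [nu],
    which is then an algebra endomorphism. *)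
Record twisted_coordinate (nu : R -> R) (g : M) (psi : M -> R) : Prop :=
  TwistedCoordinate {
    psi_linear : linear psi;
    psi_inj : injective psi;
    psi_gen : psi g = 1;
    psi_lact : forall r m, psi (lact r m) = r * psi m;
    psi_ract : forall m r, psi (ract m r) = psi m * nu r
  }.

Variables (nu : R -> R) (g : M) (psi : M -> R).
Hypothesis tw : twisted_coordinate nu g psi.
Local Notation T := (tpow M).

Lemma lact_psi m : lact (psi m) g = m.
Proof. by apply: (psi_inj tw); rewrite (psi_lact tw) (psi_gen tw) mulr1. Qed.

Lemma nu_psi r : nu r = psi (ract g r).
Proof. by rewrite (psi_ract tw) (psi_gen tw) mul1r. Qed.

Lemma nu_linear : linear nu.
Proof. by move=> a r s; rewrite !nu_psi ract_linear (psi_linear tw). Qed.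

Lemma nu1 : nu 1 = 1.
Proof. by rewrite nu_psi ract1 (psi_gen tw). Qed.

Lemma nuM r s : nu (r * s) = nu r * nu s.
Proof. by rewrite (nu_psi (r * s)) ractM (psi_ract tw) -nu_psi. Qed.

Lemma iter_nu_linear k : linear (iter k nu).
Proof. by elim: k => [|k IH] a r s //=; rewrite IH nu_linear. Qed.

Lemma iter_nuM k r s : iter k nu (r * s) = iter k nu r * iter k nu s.
Proof. by elim: k => [|k IH] //=; rewrite IH nuM. Qed.

(** The coordinate of a tensor on the generator [g (x) ... (x) g]. *)
Fixpoint kappa (k : nat) : T k -> R :=
  match k return T k -> R with
  | 0 => fun r => r
  | k1.+1 =>
      match k1 return (T k1 -> R) -> T k1.+1 -> R with
      | 0 => fun _ m => psi m
      | k'.+1 => fun rec =>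
          tens_lift (fun (m : M) (y : T k'.+1) => psi m * nu (rec y) : R)
      end (@kappa k1)
  end.

Lemma kappa_balanced k : linear (@kappa k.+1 : T k.+1 -> R) ->
    (forall r (y : T k.+1), kappa (lact r y) = r * kappa y) ->
  balanced (fun (m : M) (y : T k.+1) => psi m * nu (kappa y) : R).
Proof.
move=> kl kr; split=> [y|m|m r y].
- exact: linear_comp (rmul_linear _) (psi_linear tw).
- exact: linear_comp (lmul_linear _) (linear_comp nu_linear kl).
- by rewrite (psi_ract tw) kr nuM mulrA.
Qed.

(** The three properties are proved together: the map [kappa] in degree
    [k + 2] descends to the tensor product only because [kappa] is left linear
    in degree [k + 1]. *)
Lemma kappa_spec k : [/\ linear (@kappa k : T k -> R),
  forall r (y : T k), kappa (lact r y) = r * kappa y &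
  forall m (y : T k), kappa (tcons m y : T k.+1) = psi m * nu (kappa y)].
Proof.
elim: k => [|k [IHl IHr IHc]].
  by split=> // m y; apply: (psi_ract tw).
have kl : linear (@kappa k.+1 : T k.+1 -> R).
  case: k IHl IHr {IHc} => [|k] IHl IHr; first exact: (psi_linear tw).
  exact: tens_lift_linear (kappa_balanced IHl IHr).
have kr r (y : T k.+1) : kappa (lact r y) = r * kappa y.
  move: y; apply: tcons_ind => [m y|x y ex ey].
    by rewrite tcons_lact !IHc (psi_lact tw) mulrA.
  by rewrite (linD (lact_linear r)) !(linD kl) ex ey mulrDr.
split=> // m y; exact: (tens_liftE (kappa_balanced kl kr)).
Qed.

Lemma kappa_linear k : linear (@kappa k : T k -> R).
Proof. by case: (kappa_spec k). Qed.
Lemma kappa_lact k r (y : T k) : kappa (lact r y) = r * kappa y.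
Proof. by case: (kappa_spec k). Qed.
Lemma kappa_tcons k m (y : T k) :
  kappa (tcons m y : T k.+1) = psi m * nu (kappa y).
Proof. by case: (kappa_spec k). Qed.

Lemma kappa_concat i j (x : T i) (y : T j) :
  kappa (concat x y) = kappa x * iter i nu (kappa y).
Proof.
elim: i x => [|i IH] x; first exact: kappa_lact.
move: x; apply: tcons_ind => [m x|x x' ex ex'].
  rewrite concat_tcons [LHS]kappa_tcons IH kappa_tcons.
  by rewrite nuM mulrA.
rewrite (linD (concat_linearl y)) (linD (kappa_linear (k := _))).
by rewrite [in RHS](linD (kappa_linear (k := _))) ex ex' mulrDl.
Qed.

Lemma kappa_ract k (y : T k) r : kappa (ract y r) = kappa y * iter k nu r.
Proof.
elim: k y => [|k IH] y //; move: y; apply: tcons_ind => [m y|x y ex ey].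
  by rewrite tcons_ract !kappa_tcons IH nuM mulrA.
rewrite (linD (ract_linearl r)) (linD (kappa_linear (k := _))).
by rewrite [in RHS](linD (kappa_linear (k := _))) ex ey mulrDl.
Qed.

Definition gpow k : T k := ptens k (fun=> g).

Lemma kappa_gpow k : kappa (gpow k) = 1.
Proof.
elim: k => // k IH.
by rewrite /gpow ptens_tcons kappa_tcons IH (psi_gen tw) nu1 mulr1.
Qed.

Lemma lact_kappa k (y : T k) : lact (kappa y) (gpow k) = y.
Proof.
elim: k y => [|k IH] y; first exact: mulr1.
move: y; apply: tcons_ind => [m y|x y ex ey].
  rewrite kappa_tcons lactM /gpow ptens_tcons !tcons_lact -/(gpow k).
  have -> : lact (nu (kappa y)) g = ract g (kappa y).
    by rewrite nu_psi lact_psi.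
  by rewrite -lractA lact_psi tcons_balanced IH.
by rewrite (linD (kappa_linear (k := _))) (linD (lact_linearl _)) ex ey.
Qed.

Lemma kappa_lact_gpow k r : kappa (lact r (gpow k)) = r.
Proof. by rewrite kappa_lact kappa_gpow mulr1. Qed.

(** A bimodule isomorphism is determined by the image of the generator. *)
Lemma tpow_regular_iso k : finite_dimensional R ->
  bimod_isomorphic (tpow M k) (regular R) <->
  exists w v : R,
    [/\ w * v = 1, v * w = 1 & forall s, iter k nu s * w = w * s].
Proof.
move=> R_fd; split=> [[f [[fl fL fR] [f' fK f'K]]]|[w [v [wv vw wC]]]].
  have fE y : f y = (kappa y * (f (gpow k) : R) : R).
    by rewrite -{1}[y]lact_kappa fL.
  pose v := kappa (f' (1 : R)).
  have vw : v * (f (gpow k) : R) = 1 by rewrite /v -fE f'K.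
  exists (f (gpow k)), v; split=> // [|s]; first exact: fd_one_sided_inverse.
  have /= := fE (ract (gpow k) s).
  by rewrite kappa_ract kappa_gpow mul1r => <-; rewrite fR.
exists (fun y => kappa y * w : R); split.
  split=> [|r m|m r].
  - exact: linear_comp (rmul_linear _) (kappa_linear (k := _)).
  - by rewrite kappa_lact -mulrA.
  - by rewrite kappa_ract -mulrA wC mulrA.
exists (fun r : R => lact (r * v) (gpow k)) => [y|r].
  by rewrite -mulrA wv mulr1 lact_kappa.
by rewrite kappa_lact_gpow -mulrA vw mulr1.
Qed.

End TwistedBimodule.

(** * Linear maps on the tensor algebra *)

Section TensorAlgebraLift.
Variables (K : fieldType) (R : kalgType K) (M : bimodType R).
Local Notation T := (tpow M).

Lemma hom_elt_linear k : linear (@hom_elt K R M k).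
Proof.
move=> a x y; apply: talgP => i.
exact: (inj_linear i a x y).
Qed.

Lemma talg_ind (P : talg M -> Prop) :
    (forall k (y : T k), P (hom_elt y)) ->
    (forall f g, P f -> P g -> P (f + g)) -> forall f, P f.
Proof.
move=> Ph PD f; have [N fN] := talg_supp f.
have -> : f = \sum_(i < N) hom_elt (f i).
  apply: talgP => k.
  have cl : linear (fun h : talg M => talg_coef h k) by [].
  rewrite (lin_sum cl) /talg_coef /=.
  have [kN|Nk] := ltnP k N.
    rewrite (bigD1 (Ordinal kN)) //= Defs.inj_eq big1 ?addr0 // => j jk.
    by rewrite inj_neq //; apply: contra jk => /eqP jk; apply/eqP/val_inj.
  rewrite [LHS]fN // big1 // => j _.
  by rewrite inj_neq // ltn_eqF // (leq_trans (ltn_ord j)).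
elim/big_ind: _ => //.
by rewrite -(lin0 (hom_elt_linear (k := 0))).
Qed.

Section Lift.
Variables (W : lmodType K) (F : forall k, T k -> W).
Hypothesis F_linear : forall k, linear (@F k).

(** The summation bound is any bound of the support; [talg_liftE] shows that
    the choice is immaterial. *)
Definition talg_lift (f : talg M) : W :=
  \sum_(k < projT1 (cid (talg_supp f))) F (f k).

Lemma talg_liftE N (f : talg M) : (forall i, (N <= i)%N -> f i = 0) ->
  talg_lift f = \sum_(k < N) F (f k).
Proof.
rewrite /talg_lift; case: cid => N' /= fN' fN.
have w n m : (forall i, (n <= i)%N -> f i = 0) -> (n <= m)%N ->
    \sum_(k < n) F (f k) = \sum_(k < m) F (f k).
  move=> fn nm; rewrite -!(big_mkord xpredT (fun k => F (f k))).
  rewrite [RHS](big_cat_nat (leq0n n) nm) //= [X in _ = _ + X]big_nat.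
  rewrite [X in _ = _ + X]big1 ?addr0 //.
  by move=> i /andP[ni _]; rewrite fn // (lin0 (F_linear (k := _))).
by rewrite (w _ (maxn N N')) ?leq_maxr // (w N (maxn N N')) ?leq_maxl.
Qed.

Lemma talg_lift_linear : linear talg_lift.
Proof.
move=> a f g; have [N fN] := talg_supp f; have [N' gN'] := talg_supp g.
have fM i : (maxn N N' <= i)%N -> f i = 0.
  by rewrite geq_max => /andP[/fN].
have gM i : (maxn N N' <= i)%N -> g i = 0.
  by rewrite geq_max => /andP[_ /gN'].
have hE i : (a *: f + g) i = a *: f i + g i by [].
have hM i : (maxn N N' <= i)%N -> (a *: f + g) i = 0.
  by move=> Ni; rewrite hE fM // gM // scaler0 addr0.
rewrite (talg_liftE fM) (talg_liftE gM) (talg_liftE hM) scaler_sumr -big_split.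
by apply: eq_bigr => i _ /=; rewrite -F_linear.
Qed.

Lemma talg_lift_hom k (y : T k) : talg_lift (hom_elt y) = F y.
Proof.
have yN i : (k.+1 <= i)%N -> hom_elt y i = 0.
  by move=> ki; rewrite /talg_coef /= inj_neq // ltn_eqF.
rewrite (talg_liftE yN) big_ord_recr /= Defs.inj_eq big1 ?add0r //.
move=> i _; rewrite inj_neq ?(lin0 (F_linear (k := _))) //.
by rewrite gtn_eqF.
Qed.

End Lift.

Lemma hom_eltM i j (x : T i) (y : T j) :
  kmul (hom_elt x) (hom_elt y) = hom_elt (concat x y).
Proof.
apply: talgP => k; rewrite /talg_coef /= /cauchy.
rewrite exchange_big /=.
under eq_bigr => b _ do rewrite concat_inj_suml //.
by rewrite concat_inj_sumr.
Qed.

End TensorAlgebraLift.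

(** * Quotients of skew polynomial rings *)

Section Monomial.
Variables (K : fieldType) (R : kalgType K) (n : nat).
Implicit Type w : {ffun 'I_n -> R}.

Definition monomial (r : R) (k : nat) : {ffun 'I_n -> R} :=
  [ffun i : 'I_n => if i == k :> nat then r else 0].

Lemma monomial_sum w : w = \sum_(i < n) monomial (w i) i.
Proof.
apply/ffunP => j; rewrite sum_ffunE (bigD1 j) //= ffunE eqxx big1 ?addr0 //.
move=> i ij; rewrite ffunE; case: eqP => // /val_inj ji.
by rewrite ji eqxx in ij.
Qed.

End Monomial.
Arguments monomial {K R n}.

(** [B] is generated by the image of [R] and by [x] subject to
    [x r = nu(r) x] and [x^n = c], and [coord] witnesses that
    [1, x, ..., x^(n-1)] is free over [R]. *)
Record skew_quotient (K : fieldType) (R B : kalgType K) (n : nat)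
    (nu : R -> R) (c : R) (iota : R -> B) (x : B)
    (coord : B -> {ffun 'I_n -> R}) : Prop := SkewQuotient {
  iota_linear : linear iota;
  iotaM : forall r s, iota (r * s) = iota r * iota s;
  x_iota : forall r, x * iota r = iota (nu r) * x;
  x_pow : x ^+ n = iota c;
  skew_span : forall P : B -> Prop,
    (forall r i, (i < n)%N -> P (iota r * x ^+ i)) ->
    (forall a b, P a -> P b -> P (a + b)) -> forall b, P b;
  coord_linear : linear coord;
  coord_monomial : forall r i, (i < n)%N ->
    coord (iota r * x ^+ i) = monomial r i
}.

(** The free left module on [e_0, ..., e_(n-1)] on which [x] acts as the twisted
    cyclic shift with [x e_(n-1) = c e_0].  Letting the tensor algebra act on
    it shows that the relation [x^n = c] kills no nonzero combination of
    [1, x, ..., x^(n-1)].  The rank is [n.+1] below. *)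
Section Model.
Variables (K : fieldType) (R : kalgType K) (nu : R -> R) (c : R) (n : nat).
Hypotheses (nu_lin : linear nu) (nu_mul : forall r s, nu (r * s) = nu r * nu s).
Hypotheses (nu_one : nu 1 = 1) (nu_c : nu c = c).
Hypothesis nu_comm : forall r, iter n.+1 nu r * c = c * r.
Local Notation W := {ffun 'I_n.+1 -> R}.
Implicit Type w : W.

Definition shift w : W :=
  [ffun i : 'I_n.+1 =>
     if i == 0%N :> nat then nu (w ord_max) * c else nu (w (inord i.-1))].

Definition dil (r : R) w : W := [ffun i => r * w i].

Lemma shift_linear : linear shift.
Proof.
move=> a v w; apply/ffunP => i; rewrite !ffunE !nu_lin; case: eqP => _ //.
by rewrite mulrDl kscalerAl.
Qed.

Lemma dil_linear r : linear (dil r).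
Proof. by move=> a v w; apply/ffunP => i; rewrite !ffunE mulrDr kscalerAr. Qed.

Lemma dil_linearl w : linear (dil^~ w).
Proof. by move=> a r s; apply/ffunP => i; rewrite !ffunE mulrDl kscalerAl. Qed.

Lemma dilM r s w : dil (r * s) w = dil r (dil s w).
Proof. by apply/ffunP => i; rewrite !ffunE mulrA. Qed.

Lemma shift_dil r w : shift (dil r w) = dil (nu r) (shift w).
Proof.
by apply/ffunP => i; rewrite !ffunE !nu_mul; case: eqP; rewrite ?mulrA.
Qed.

Lemma iter_shift_dil k r w :
  iter k shift (dil r w) = dil (iter k nu r) (iter k shift w).
Proof. by elim: k => //= k ->; rewrite shift_dil. Qed.

Lemma iter_shift_linear k : linear (iter k shift).
Proof. by elim: k => [|k IH] a v w //=; rewrite IH shift_linear. Qed.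

Lemma dil_monomial r s k : dil r (monomial s k) = monomial (r * s) k.
Proof. by apply/ffunP => i; rewrite !ffunE; case: eqP; rewrite ?mulr0. Qed.

Lemma shift_monomial k : (k < n)%N -> shift (monomial 1 k) = monomial 1 k.+1.
Proof.
move=> kn; apply/ffunP => i; rewrite !ffunE.
have nu0 : nu 0 = 0 by exact: lin0 nu_lin.
case: i => -[|i] ilt /=; first by rewrite gtn_eqF // nu0 mul0r.
by rewrite inordK 1?ltnW // eqSS; case: eqP.
Qed.

Lemma shift_last : shift (monomial 1 n) = monomial c 0.
Proof.
have nu0 : nu 0 = 0 by exact: lin0 nu_lin.
apply/ffunP => i; rewrite !ffunE; case: i => -[|i] ilt /=.
  by rewrite eqxx nu_one mul1r.
by rewrite inordK 1?ltnW // ltn_eqF.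
Qed.

Lemma iter_shift_monomial k : (k <= n)%N ->
  iter k shift (monomial 1 0) = monomial 1 k.
Proof. by elim: k => //= k IH kn; rewrite IH ?shift_monomial // ltnW. Qed.

Lemma iter_nu_c k : iter k nu c = c.
Proof. by elim: k => //= k ->. Qed.

(** It suffices to look at [r e_i = r x^i e_0], where
    [x^n r x^i e_0 = nu^n(r) x^i c e_0 = nu^n(r) c x^i e_0 = c r x^i e_0]. *)
Lemma iter_shiftn w : iter n.+1 shift w = dil c w.
Proof.
have l : linear (iter n.+1 shift) by exact: iter_shift_linear.
rewrite [w]monomial_sum (lin_sum l) (lin_sum (dil_linear c)).
apply: eq_bigr => i _; set r := w i.
have -> : monomial r i = dil r (iter i shift (monomial 1 0)).
  by rewrite iter_shift_monomial ?dil_monomial ?mulr1 // -ltnS.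
rewrite iter_shift_dil -iterD addnC iterD [iter n.+1 shift _]iterS.
rewrite (iter_shift_monomial (leqnn n)) shift_last.
have -> : monomial c 0 = dil c (monomial 1 0) :> W.
  by rewrite dil_monomial mulr1.
by rewrite iter_shift_dil iter_nu_c -!dilM nu_comm.
Qed.

End Model.

Arguments shift {K R} nu c {n} w.

Section FactorAlgebraPresentation.
Variables (K : fieldType) (R : kalgType K) (M : bimodType R).
Variables (nu : R -> R) (g : M) (psi : M -> R).
Hypothesis tw : twisted_coordinate nu g psi.
Variables (n : nat) (phi : tpow M n.+1 -> regular R).
Hypotheses (phi_hom : bimod_hom phi) (phi_assoc : associative_map phi).
Local Notation T := (tpow M).
Local Notation W := {ffun 'I_n.+1 -> R}.
Local Notation kappa := (kappa nu psi).
Local Notation gpow := (gpow g).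

(** The element [c] for which the relation of the factor algebra becomes
    [x^n = c]. *)
Definition modulus : R := phi (gpow n.+1).

Lemma phiE y : phi y = (kappa y * modulus : R).
Proof. by case: phi_hom => _ fL _; rewrite -{1}[y](lact_kappa tw) fL. Qed.

Lemma modulus_comm r : iter n.+1 nu r * modulus = modulus * r.
Proof.
have := phiE (ract (gpow n.+1) r).
rewrite (kappa_ract tw) (kappa_gpow tw) mul1r => <-.
by case: phi_hom => _ _ ->.
Qed.

Lemma nu_modulus : nu modulus = modulus.
Proof.
have := congr1 psi (phi_assoc (fun=> g)).
by rewrite (psi_lact tw) (psi_ract tw) (psi_gen tw) mulr1 mul1r.
Qed.

Local Notation shift := (shift nu modulus).
Local Notation e0 := (monomial 1 0 : W).

(** A homogeneous element [r g^k] acts as [r] times the [k]th power of the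
    shift. *)
Definition act_hom w k (y : T k) : W := dil (kappa y) (iter k shift w).

Lemma act_hom_linear w k : linear (@act_hom w k).
Proof. by move=> a x y; rewrite /act_hom (kappa_linear tw) dil_linearl. Qed.

Definition act (f : talg M) (w : W) : W := talg_lift (act_hom w) f.

Lemma act_linearl w : linear (act^~ w).
Proof. exact: talg_lift_linear (act_hom_linear w). Qed.

Lemma act_hom_elt k (y : T k) w : act (hom_elt y) w = act_hom w y.
Proof. exact: talg_lift_hom (act_hom_linear w) _ _. Qed.

Lemma act0 f : act f 0 = 0.
Proof.
move: f; apply: talg_ind => [k y|f h ef eh].
  rewrite act_hom_elt /act_hom (lin0 (iter_shift_linear _ (nu_linear tw) _)).
  exact: lin0 (dil_linear _).
by rewrite (linD (act_linearl _)) ef eh addr0.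
Qed.

Lemma act_hom_linearr k (y : T k) : linear (fun w => act_hom w y).
Proof.
apply: linear_comp (dil_linear _) (iter_shift_linear _ (nu_linear tw) _).
Qed.

Lemma actM (f h : talg M) w : act (kmul f h) w = act f (act h w).
Proof.
move: f; apply: talg_ind => [i y|f f' ef ef']; last first.
  by rewrite (linD (kmul_linearl h)) !(linD (act_linearl _)) ef ef'.
move: h; apply: talg_ind => [j z|h h' eh eh']; last first.
  rewrite (linD (kmul_linear _)) !(linD (act_linearl _)) eh eh' !act_hom_elt.
  by rewrite (linD (act_hom_linearr y)).
rewrite hom_eltM !act_hom_elt /act_hom (kappa_concat tw) dilM iterD.
by rewrite (iter_shift_dil _ (nuM tw)).
Qed.

Local Open Scope classical_set_scope.

(** The annihilator of the module is a two-sided ideal, so it contains the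
    ideal as soon as it contains the relations. *)
Lemma act_phi_relations f : gen_ideal (phi_relations phi) f ->
  forall w, act f w = 0.
Proof.
move/(_ [set h | forall w, act h w = 0]); apply; first split; first split.
- by move=> w; rewrite (lin0 (act_linearl w)).
- by move=> f1 h ef eh w; rewrite (linD (act_linearl w)) ef eh addr0.
- by move=> f1 h eh w; rewrite [LHS]actM eh act0.
- by move=> f1 h eh w; rewrite [LHS]actM eh.
move=> _ [m ->] w; rewrite (linB (act_linearl w)) !act_hom_elt /act_hom.
rewrite (iter_shiftn (nu_linear tw) (nuM tw) (nu1 tw) nu_modulus modulus_comm).
by rewrite phiE -dilM subrr.
Qed.

Local Close Scope classical_set_scope.

Local Notation FA := (factor_algebra phi : kalgType K).

Definition fa_quo (f : talg M) : FA := quo f.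
Definition fa_iota (r : R) : FA := fa_quo (hom_elt (r : T 0)).
Definition fa_x : FA := fa_quo (hom_elt (g : T 1)).
Definition fa_coord (b : FA) : W := act (repr b) e0.

Lemma fa_coord_quo f : fa_coord (fa_quo f) = act f e0.
Proof.
apply/eqP; rewrite -subr_eq0 -(linB (act_linearl e0)).
rewrite act_phi_relations //.
by apply/spanned_gen_ideal/quo_eqP; rewrite /quo reprK.
Qed.

Lemma fa_quo_linear : linear fa_quo.
Proof. exact: quo_is_linear. Qed.

Lemma fa_quoM f h : kmul (fa_quo f) (fa_quo h) = fa_quo (kmul f h).
Proof. exact: quo_mulE. Qed.

Lemma fa_monomial k (y : T k) :
  fa_quo (hom_elt y) = kmul (fa_iota (kappa y)) (fa_quo (hom_elt (gpow k))).
Proof. by rewrite fa_quoM hom_eltM /= (lact_kappa tw). Qed.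

Lemma fa_pow k : fa_quo (hom_elt (gpow k)) = fa_x ^+ k.
Proof.
elim: k => [|k IH] //; rewrite exprS -IH [RHS]fa_quoM hom_eltM.
by rewrite {1}/gpow ptens_tcons.
Qed.

Lemma fa_relation : fa_quo (hom_elt (gpow n.+1)) = fa_iota modulus.
Proof.
apply/quo_eqP/spanned_gen_ideal => I _; apply.
by exists (fun=> g).
Qed.

(** Freeness comes from the action: [r x^i] sends [e_0] to [r e_i]. *)
Lemma factor_algebra_skew : skew_quotient nu modulus fa_iota fa_x fa_coord.
Proof.
have fa_pow_mod : fa_x ^+ n.+1 =
    fa_iota modulus.
  by rewrite -fa_pow fa_relation.
split=> // [||r|P Pm PD b||r i ilt].
- exact: linear_comp fa_quo_linear (hom_elt_linear (k := 0)).
- by move=> r s; rewrite [RHS]fa_quoM hom_eltM.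
- rewrite [LHS]fa_quoM [RHS]fa_quoM !hom_eltM; congr (fa_quo (hom_elt _)).
  by rewrite /= (nu_psi tw) (lact_psi tw).
- have Px k r : P (kmul (fa_iota r) (fa_x ^+ k)).
    elim/ltn_ind: k r => k IH r; have [kn|nk] := ltnP k n.+1; first exact: Pm.
    rewrite -(subnK nk) addnC exprD fa_pow_mod.
    rewrite -[_ * _]/(kmul _ _) kmulA fa_quoM hom_eltM.
    by apply: IH; rewrite ltn_subrL (leq_trans _ nk).
  have [f ->] := quo_surj b; move: f.
  apply: talg_ind => [k y|f h ef eh]; last by rewrite quoD; apply: PD.
  by rewrite [quo _]fa_monomial fa_pow.
- move=> a b b'; have [f ->] := quo_surj b; have [h ->] := quo_surj b'.
  by rewrite -[_ + _]fa_quo_linear !fa_coord_quo act_linearl.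
rewrite -fa_pow -[LHS]/(fa_coord (kmul _ _)) fa_quoM fa_coord_quo hom_eltM.
rewrite act_hom_elt /act_hom [kappa _](kappa_lact_gpow tw).
rewrite iter_shift_monomial ?dil_monomial ?mulr1 //.
  exact: nu_linear tw.
exact: nu1 tw.
Qed.

End FactorAlgebraPresentation.

(** * Frobenius forms *)

Section FrobeniusForm.
Variables (K : fieldType) (R : kalgType K).

(** The form [lam] corresponds to [1] under the left isomorphism of the
    dual with [R]. *)
Lemma frobenius_twisted : left_isomorphic (dual R) (regular R) ->
  exists (lam : dual R) (nu : R -> R) (psi : dual R -> R),
    twisted_coordinate nu lam psi.
Proof.
move=> [psi [[psil psiL] [psi' psiK psi'K]]]; pose lam := psi' (1 : R).
have lamE m : lact (psi m : R) lam = m.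
  by apply: (can_inj psiK); rewrite psiL /lam psi'K; apply: mulr1.
exists lam, (fun r => psi (ract lam r)), psi; split=> // [||m r].
- exact: can_inj psiK.
- by rewrite /lam psi'K.
- by rewrite -{1}[m]lamE lractA psiL.
Qed.

Variables (lam : dual R) (nu : R -> R) (psi : dual R -> R).
Hypotheses (R_fd : finite_dimensional R) (tw : twisted_coordinate nu lam psi).

Lemma lam_dual (p : dual R) r : p r = lam (r * psi p).
Proof. by rewrite -{1}[p](lact_psi tw). Qed.

Lemma lam_nu r s : lam (r * s) = lam (s * nu r).
Proof. by rewrite (nu_psi tw) -lam_dual. Qed.

Lemma lam_inj_r (a : R) : (forall s, lam (s * a) = 0) -> a = 0.
Proof.
move=> a0; have : lact a lam = 0 by apply: dualP => s; apply: a0.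
move/(congr1 psi); rewrite (psi_lact tw) (psi_gen tw) mulr1 => ->.
exact: lin0 (psi_linear tw).
Qed.

Lemma lam_inj_l (a : R) : (forall s, lam (a * s) = 0) -> a = 0.
Proof. by move=> a0; apply: (dual_separates R_fd) => p; rewrite lam_dual. Qed.

Lemma lam_nu_id r : lam (nu r) = lam r.
Proof. by rewrite -[nu r]mul1r -lam_nu mulr1. Qed.

Lemma lam_iter_nu k r : lam (iter k nu r) = lam r.
Proof. by elim: k => //= k IH; rewrite lam_nu_id. Qed.

Lemma nu_surj s : exists r, nu r = s.
Proof.
apply: (fd_inj_surj R_fd (nu_linear tw)) => r r0.
by apply: lam_inj_l => s'; rewrite lam_nu r0 mulr0 (lin0 (dual_linear lam)).
Qed.

Lemma iter_nu_surj k s : exists r, iter k nu r = s.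
Proof.
elim: k s => [|k IH] s; first by exists s.
by have [r <-] := nu_surj s; have [r' <-] := IH r; exists r'.
Qed.

Lemma lam_eq_r (a b : R) : (forall s, lam (s * a) = lam (s * b)) -> a = b.
Proof.
move=> ab; apply/eqP; rewrite -subr_eq0; apply/eqP/lam_inj_r => s.
by rewrite mulrBr (linB (dual_linear lam)) ab subrr.
Qed.

(** First [nu^k(w) = w], from [nu^k(w) w = w w].  As [lam] is [nu]-invariant,
    [lam(s nu(w)) = lam(w s) = lam(nu^k(s) w) = lam(nu^k(s w)) = lam(s w)]. *)
Lemma intertwiner_fixed k (w v : R) : w * v = 1 ->
  (forall s, iter k nu s * w = w * s) -> nu w = w.
Proof.
move=> wv wC.
have wk : iter k nu w = w by rewrite -[LHS]mulr1 -wv mulrA wC -mulrA wv mulr1.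
apply: lam_eq_r => s; rewrite -lam_nu -wC -{1}wk -(iter_nuM tw).
exact: lam_iter_nu.
Qed.

(** The trace identity for [a x^i] and [b x^j], when the trace of [r x^(k+1)]
    is [lam(r w)].  Applying [nu^i] inside [lam] turns the right-hand side into
    [lam(nu^i(b) nu^k(nu(a)) w) = lam(nu^i(b) w nu(a))]. *)
Lemma intertwiner_trace i j k (a b w : R) : (i + j = k.+1)%N -> nu w = w ->
    (forall s, iter k nu s * w = w * s) ->
  lam (a * iter i nu b * w) = lam (b * iter j nu a * w).
Proof.
move=> ijk nuw wC; have iw : iter i nu w = w by elim: (i) => //= ? ->.
rewrite -[RHS](lam_iter_nu i) !(iter_nuM tw) iw -iterD ijk iterSr.
by rewrite -[in RHS]mulrA wC (mulrA (iter i nu b)) -lam_nu mulrA.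
Qed.

(** If the right ideal [a R + b R] were proper, a nonzero form would vanish on
    it; such a form is [lam(s _)], and nondegeneracy gives [s a = s b = 0]. *)
Lemma bezout_of_annihilator (a b : R) :
    (forall s : R, s * a = 0 -> s * b = 0 -> s = 0) ->
  exists p q : R, a * p + b * q = 1.
Proof.
have [n [f [fl [f' fK f'K]]]] := R_fd; have f'l := linear_inverse fl fK f'K.
pose A (e : R) := \matrix_i f (e * f' (delta_mx 0 i)).
have AE e u : u *m A e = f (e * f' u).
  rewrite [u in RHS]row_sum_delta (lin_sum f'l) (lin_sum (lmul_linear e)).
  rewrite (lin_sum fl) mulmx_sum_row; apply: eq_bigr => i _.
  by rewrite rowK (linZ f'l) (linZ (lmul_linear e)) (linZ fl).
move=> ab0; pose C := cokermx (col_mx (A a) (A b)).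
have [AC BC] : A a *m C = 0 /\ A b *m C = 0.
  by have := mulmx_coker (col_mx (A a) (A b)); rewrite mul_col_mx -col_mx0
    => /eq_col_mx.
have fC0 e : f e *m C = 0.
  apply/rowP => j; rewrite [RHS]mxE.
  have pl : linear (fun r => (f r *m C) 0 j : K^o).
    by move=> x r s; rewrite fl mulmxDl -scalemxAl !mxE.
  pose p : dual R := Dual (linear_form_of pl).
  (* [nu s = psi p] is what makes [p] equal to [lam (s * _)] *)
  have [s sp] := nu_surj (psi p).
  have pE r : p r = lam (s * r) by rewrite lam_dual -sp -lam_nu.
  have p0 e' : A e' *m C = 0 -> s * e' = 0.
    move=> eC; apply: lam_inj_l => r; rewrite -mulrA -pE /p /=.
    by rewrite -[r]fK -AE -mulmxA eC mulmx0 mxE.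
  by rewrite -[LHS]/(p e) pE (ab0 s) ?p0 // mul0r (lin0 (dual_linear lam)).
have C0 : C = 0.
  apply/row_matrixP => i; rewrite row0.
  by have := fC0 (f' (delta_mx 0 i)); rewrite f'K -rowE.
have full : row_full (col_mx (A a) (A b)) by rewrite -cokermx_eq0 -/C C0.
have /row_fullP[D DE] := full.
have := congr1 (mulmx (f 1)) DE; rewrite mulmx1 mulmxA.
rewrite -[f 1 *m D]hsubmxK mul_row_col !AE -(linD fl) => /(can_inj fK) <-.
by exists (f' (lsubmx (f 1 *m D))), (f' (rsubmx (f 1 *m D))).
Qed.

End FrobeniusForm.

(** * Local algebras *)

Section LocalAlgebra.
Variables (K : fieldType) (R : kalgType K).
Local Open Scope classical_set_scope.

Lemma left_ideal_maximal (I : set R) : left_ideal I -> I <> setT ->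
  exists2 J, maximal_left_ideal J & I `<=` J.
Proof.
have unitT (J : set R) : left_ideal J -> J 1 -> J = setT.
  case=> _ _ Jl J1; apply/seteqP; split=> // x _.
  by rewrite -[x]mulr1; apply: Jl.
move=> Il IT; have I1 : ~ I 1 by move/(unitT _ Il).
have [I0 ID Im] := Il.
(* Adding [I] inside [P] makes the empty chain harmless in Zorn's lemma. *)
pose P (A : set R) := left_ideal (A `|` I) /\ ~ (A `|` I) 1.
have [F FP Ftot|A [[Al A1] Amax]] := @Zorn_bigcup R P.
  rewrite /P; set U := \bigcup_(X in F) X.
  have XU X y : F X -> (X `|` I) y -> (U `|` I) y.
    by move=> FX [Xy|Iy]; [left; exists X|right].
  have XD X y z : F X -> (X `|` I) y -> (X `|` I) z -> (U `|` I) (y + z).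
    by move=> FX Xy Xz; have [[_ D _] _] := FP _ FX; apply/(XU X)/D.
  split; last by move=> [[X /FP[_ X1] X1']|//]; apply: X1; left.
  split=> [|y z|r y]; first by right.
  - move=> [[X FX Xy]|Iy] [[Y FY Yz]|Iz].
    + have [XY|YX] := Ftot _ _ FX FY.
        by apply: (XD Y) => //; left=> //; apply: XY.
      by apply: (XD X) => //; left=> //; apply: YX.
    + by apply: (XD X) => //; [left|right].
    + by apply: (XD Y) => //; [right|left].
    + by right; apply: ID.
  - move=> [[X FX Xy]|Iy]; last by right; apply: Im.
    by have [[_ _ D] _] := FP _ FX; apply/(XU X)/D => //; left.
exists (A `|` I) => //; split=> // [AT|J Jl AJ JT].
  by apply: A1; rewrite AT.
apply: contrapT => JA; apply: (Amax J).
  rewrite properEneq; split; last by apply: subset_trans AJ; left.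
  apply/eqP => AJe; apply: JA; rewrite -AJe.
  by apply/seteqP; split=> x; [left|move=> /AJ; rewrite -AJe].
have JI : J `|` I = J.
  apply/seteqP; split=> x; last by left.
  by move=> [//|Ix]; apply: AJ; right.
by rewrite /P JI; split=> // /(unitT _ Jl).
Qed.

(** If neither were left invertible, [R a] and [R b] would both lie in the
    maximal left ideal, which would then contain [1]. *)
Lemma local_sum_unit (a b : R) : local_algebra R -> a + b = 1 ->
  (exists v, v * a = 1) \/ exists v, v * b = 1.
Proof.
move=> [J [Jmax Juniq]] ab1; apply: contrapT => /not_orP[a0 b0].
have prin (e : R) : ~ (exists v, v * e = 1) -> J e.
  move=> e0; pose I := [set x : R | exists r, x = r * e].
  have Il : left_ideal I.
    split=> [|_ _ [r ->] [s ->]|r _ [s ->]].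
    - by exists 0; rewrite mul0r.
    - by exists (r + s); rewrite mulrDl.
    - by exists (r * s); rewrite mulrA.
  have IT : I <> setT.
    move=> IT; apply: e0; have : I 1 by rewrite IT.
    by move=> [v ->]; exists v.
  have [J' /Juniq <- IJ] := left_ideal_maximal Il IT.
  by apply: IJ; exists 1; rewrite mul1r.
have [[_ JD Jm] JT _] := Jmax; apply: JT; apply/seteqP; split=> // x _.
by rewrite -[x]mulr1 -ab1; apply: Jm; apply: JD; apply: prin.
Qed.

End LocalAlgebra.

(** * Trace forms on a quotient of a skew polynomial ring *)

Section SkewQuotientTrace.
Variables (K : fieldType) (R : kalgType K).
Variables (lam : dual R) (nu : R -> R) (psi : dual R -> R).
Hypotheses (R_fd : finite_dimensional R) (tw : twisted_coordinate nu lam psi).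
Variables (B : kalgType K) (m : nat) (c : R) (iota : R -> B) (x : B).
Local Notation n := m.+2.
Variable coord : B -> {ffun 'I_n -> R}.
Hypothesis sk : skew_quotient nu c iota x coord.
Hypotheses (nu_c : nu c = c) (nu_comm : forall r, iter n nu r * c = c * r).

Lemma iota0 : iota 0 = 0.
Proof. exact: lin0 (iota_linear sk). Qed.

Lemma coord_sum b : b = \sum_(i < n) iota (coord b i) * x ^+ i.
Proof.
move: b; apply: (skew_span sk) => [r i ilt|a b ea eb].
  rewrite (coord_monomial sk) // (bigD1 (Ordinal ilt)) //= ffunE eqxx.
  rewrite big1 ?addr0 // => j ji; rewrite ffunE ifN ?iota0 ?mul0r //.
rewrite {1}ea {1}eb -big_split; apply: eq_bigr => i _ /=.
by rewrite (linD (coord_linear sk)) ffunE (linD (iota_linear sk)) mulrDl.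
Qed.

Lemma coord_inj : injective coord.
Proof. by move=> a b ab; rewrite [a]coord_sum ab -coord_sum. Qed.

Lemma coord_surj (w : {ffun 'I_n -> R}) :
  coord (\sum_(i < n) iota (w i) * x ^+ i) = w.
Proof.
rewrite (lin_sum (coord_linear sk)) [RHS]monomial_sum.
by apply: eq_bigr => i _; apply: (coord_monomial sk).
Qed.

Lemma skew_quotient_fd : finite_dimensional B.
Proof.
have [d [f [fl [f' fK f'K]]]] := R_fd.
exists (n * d)%N, (fun b => mxvec (\matrix_(i, j) f (coord b i) 0 j)); split.
  move=> a b b'; rewrite -linearP; congr mxvec; apply/matrixP => i j.
  by rewrite !mxE (coord_linear sk) !ffunE fl !mxE.
exists (fun v => \sum_(i < n) iota (f' (row i (vec_mx v))) * x ^+ i) => [b|v].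
  rewrite [RHS]coord_sum; apply: eq_bigr => i _; congr (iota _ * _).
  by rewrite mxvecK -[RHS]fK; congr f'; apply/rowP => j; rewrite !mxE.
rewrite -[RHS]vec_mxK; congr mxvec; apply/matrixP => i j.
set v' := vec_mx v.
pose w := [ffun i : 'I_n => f' (row i v')].
have -> : \sum_(i < n) iota (f' (row i v')) * x ^+ i
    = \sum_(i < n) iota (w i) * x ^+ i by apply: eq_bigr => k _; rewrite ffunE.
by rewrite mxE coord_surj ffunE f'K mxE.
Qed.

Lemma pow_iota k r : x ^+ k * iota r = iota (iter k nu r) * x ^+ k.
Proof.
elim: k => [|k IH]; first by rewrite mul1r mulr1.
by rewrite exprS -mulrA IH mulrA (x_iota sk) -mulrA.
Qed.

Lemma monomialM a b i j :
  (iota a * x ^+ i) * (iota b * x ^+ j) = iota (a * iter i nu b) * x ^+ (i + j).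
Proof.
by rewrite -mulrA (mulrA (x ^+ i)) pow_iota -mulrA -exprD mulrA (iotaM sk).
Qed.

Lemma iota_pow_n a k : iota a * x ^+ (k + n) = iota (a * c) * x ^+ k.
Proof. by rewrite addnC exprD (x_pow sk) mulrA (iotaM sk). Qed.

(** The trace is [b -> lam(b_(d+1) z)], with [b_i] the coefficient of [x^i].
    For [i <= d + 1] the coefficient [a_i] is detected by multiplying on the
    right by [q x^(d+1-i)]; for larger [i] one has to wrap around the relation
    [x^n = c], which costs a factor [c].  So either [d + 1] is the top exponent,
    or [c] must be a unit. *)
Lemma twisted_trace_symmetric d (z z' : R) :
    (d.+1 < n)%N -> z * z' = 1 -> (forall s, iter d nu s * z = z * s) ->
    (d.+2 = n \/ exists c' : R, c * c' = 1) ->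
  symmetric_algebra B.
Proof.
move=> dn zz' zC dc; have lamlin := dual_linear lam.
pose D := Ordinal dn.
pose t b : K^o := lam (coord b D * z).
have tl : linear t.
  move=> a b b'; rewrite /t (coord_linear sk) !ffunE mulrDl -kscalerAl.
  exact: lamlin.
(* [t (iota r * x ^+ k) = lam (r * y k)] for [k] below [2 * n] *)
pose y k := if k == d.+1 then z else if k == (d.+1 + n)%N then c * z else 0.
have t_low k a : (k < n)%N -> t (iota a * x ^+ k) = lam (a * y k).
  move=> kn; rewrite /t (coord_monomial sk) // ffunE /y /= eq_sym.
  case: eqP => // _; rewrite ifN ?mul0r ?mulr0 //.
  by rewrite ltn_eqF // (leq_trans kn) // leq_addl.
have tE k a : (k < n + n)%N -> t (iota a * x ^+ k) = lam (a * y k).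
  move=> k2; have [kn|nk] := ltnP k n; first exact: t_low.
  move: k2; rewrite -(subnK nk) ltn_add2r; move: (k - n)%N => l ln.
  rewrite iota_pow_n t_low // -mulrA; congr (lam (_ * _)).
  have ldn : (l == d.+1 + n)%N = false by rewrite ltn_eqF // ltn_addl.
  have lnd : (l + n == d.+1)%N = false by rewrite gtn_eqF // ltn_addl.
  by rewrite /y ldn lnd eqn_add2r; case: eqP; rewrite ?mulr0.
have zfix : nu z = z by exact (intertwiner_fixed tw zz' zC).
have yC i j a b : lam (a * iter i nu b * y (i + j)%N) =
    lam (b * iter j nu a * y (i + j)%N).
  rewrite /y; case: eqP => [ijd|_].
    exact (intertwiner_trace tw a b ijd zfix zC).
  case: eqP => [ijd|_]; last by rewrite !mulr0.
  apply: (intertwiner_trace tw (k := d + n)); first by rewrite ijd addSn.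
    by rewrite (nuM tw) nu_c zfix.
  by move=> s; rewrite addnC iterD mulrA nu_comm -mulrA zC mulrA.
apply: (nondegenerate_trace_symmetric skew_quotient_fd tl) => [a b|a a0].
  move: a; apply: (skew_span sk) => [r i ilt|a a' ea ea']; last first.
    by rewrite mulrDl mulrDr !(linD tl) ea ea'.
  move: b; apply: (skew_span sk) => [s j jlt|b b' eb eb']; last first.
    by rewrite mulrDl mulrDr !(linD tl) eb eb'.
  rewrite !monomialM !tE ?yC 1?addnC //.
    by rewrite -addSn leq_add // ltnW.
  by rewrite -addSn leq_add // ltnW.
apply: coord_inj; rewrite (lin0 (coord_linear sk)); apply/ffunP => i.
rewrite [RHS]ffunE.
have z'z : z' * z = 1 by exact: fd_one_sided_inverse.
(* [x ^+ j] moves the [i]th coefficient, and no other, into the support of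
   [t] *)
have [j [jlt [v vy] y0]] : exists j, [/\ (j < n)%N,
    exists v, v * y (i + j)%N = 1 &
    forall k, (k < n)%N -> k != i -> y (k + j)%N = 0].
  have [id|di] := leqP i d.+1.
    exists (d.+1 - i)%N; split=> [||k kn ki].
    - by rewrite (leq_ltn_trans (leq_subr _ _)).
    - by exists z'; rewrite subnKC // /y eqxx.
    rewrite /y ifN; last first.
      by rewrite -[X in _ != X](subnKC id) eqn_add2r.
    by rewrite ifN // ltn_eqF // addnC -addnS leq_add ?leq_subr.
  case: dc => [dE|[c' cc']].
    by have := leq_ltn_trans di (ltn_ord i); rewrite [X in (X < _)%N]dE ltnn.
  have c'c : c' * c = 1 by exact: fd_one_sided_inverse.
  have le_i : (i <= d.+1 + n)%N.
    by rewrite (leq_trans (ltnW (ltn_ord i))) ?leq_addl.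
  exists (d.+1 + n - i)%N; split=> [||k kn ki].
  - by rewrite ltn_subLR // ltn_add2r.
  - exists (z' * c'); rewrite subnKC // /y eqxx ifN.
      by rewrite -mulrA (mulrA c') c'c mul1r.
    by rewrite gtn_eqF // -[X in (X < _)%N]addn0 ltn_add2l.
  rewrite /y ifN; last first.
    rewrite gtn_eqF // ltn_addl // -addnBA ?(ltnW (ltn_ord i)) //.
    by rewrite -[X in (X < _)%N]addn0 ltn_add2l subn_gt0.
  by rewrite ifN // -[X in _ != X](subnKC le_i) eqn_add2r.
apply: (lam_inj_l R_fd tw) => s.
have [q qE] := iter_nu_surj R_fd tw i (s * v).
have := a0 (iota q * x ^+ j); rewrite {1}[a]coord_sum mulr_suml (lin_sum tl).
rewrite (bigD1 i) //= big1 => [|k ki]; last first.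
  by rewrite monomialM tE ?y0 ?mulr0 ?(lin0 lamlin) // -addSn leq_add // ltnW.
rewrite addr0 monomialM tE; last by rewrite -addSn leq_add // ltnW.
by rewrite qE -!mulrA vy mulr1.
Qed.

(** [w] represents the trace on [R x^(n-1)].  For the second property, the
    product of [r x^i] and [s x^(n-1)] has trace [lam(r s w)] when [i = 0], and
    otherwise contains the factor [nu^i(s) c = nu^i(s c)]. *)
Lemma symmetric_intertwiner : symmetric_algebra B ->
  exists w : R, (forall s, iter m nu s * w = w * s) /\
            (forall s : R, s * w = 0 -> s * c = 0 -> s = 0).
Proof.
move=> /symmetric_trace[t [tl tC t0]].
have pl : linear (fun r => t (iota r * x ^+ m.+1)).
  by move=> a r s; rewrite (iota_linear sk) mulrDl -kscalerAl tl.
pose p : dual R := Dual (linear_form_of pl).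
have tE r : t (iota r * x ^+ m.+1) = lam (r * psi p) by rewrite -(lam_dual tw).
exists (psi p); split=> s.
  have [r <-] := nu_surj R_fd tw s; rewrite -iterSr.
  apply: (lam_eq_r tw) => q.
  rewrite !mulrA -(lam_nu tw) (mulrA r) -!tE !(iotaM sk).
  by rewrite -[in RHS]mulrA [RHS]tC -!mulrA pow_iota.
move=> sw sc; have sx0 : iota s * x ^+ m.+1 = 0.
  apply: t0; apply: (skew_span sk) => [r i _|a b ea eb]; last first.
    by rewrite mulrDl (linD tl) ea eb addr0.
  rewrite monomialM; case: i => [|i].
    by rewrite add0n tE /= -mulrA sw mulr0 (lin0 (dual_linear lam)).
  have ic k : iter k nu c = c by elim: k => //= k ->.
  rewrite addSnnS iota_pow_n -mulrA -{1}(ic i.+1) -(iter_nuM tw) sc.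
  rewrite (lin0 (iter_nu_linear tw _)) mulr0 iota0 mul0r.
  exact: lin0 tl.
have := congr1 coord sx0.
rewrite (coord_monomial sk) // (lin0 (coord_linear sk)).
by move/ffunP/(_ ord_max); rewrite !ffunE eqxx.
Qed.

End SkewQuotientTrace.

(** * Symmetry of the factor algebra *)

Section SymmetryCriteria.
Variables (K : fieldType) (R : kalgType K).
Variables (lam : dual R) (nu : R -> R) (psi : dual R -> R).
Hypotheses (R_fd : finite_dimensional R) (tw : twisted_coordinate nu lam psi).
Variables (m : nat) (phi : tpow (dual R) m.+2 -> regular R).
Hypotheses (phi_hom : bimod_hom phi) (phi_assoc : associative_map phi).
Local Notation c := (modulus lam phi).

Let sk := factor_algebra_skew tw phi_hom phi_assoc.
Let nu_c := nu_modulus tw phi_assoc.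
Let nu_comm := modulus_comm tw phi_hom.

Lemma iso_power_symmetric : bimod_isomorphic (tpow (dual R) m) (regular R) ->
  symmetric_algebra (factor_algebra phi).
Proof.
move=> /(tpow_regular_iso tw m R_fd)[w [v [wv _ wC]]].
apply: (twisted_trace_symmetric R_fd tw sk nu_c nu_comm (ltnSn _) wv wC).
by left.
Qed.

Lemma bimod_iso_modulusP :
  bimod_iso phi <-> exists v : R, c * v = 1 /\ v * c = 1.
Proof.
split=> [[_ [f _ fK]]|[v [cv vc]]].
  have vc : kappa nu psi (f (1 : R)) * c = 1.
    by have := phiE tw phi_hom (f (1 : R)); rewrite fK => <-.
  by exists (kappa nu psi (f (1 : R))); split=> //; apply: fd_one_sided_inverse.
split=> //; exists (fun r : R => lact (r * v) (gpow lam m.+2)) => [y|r].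
  by rewrite (phiE tw phi_hom) -mulrA cv mulr1 (lact_kappa tw).
by rewrite (phiE tw phi_hom) (kappa_lact_gpow tw) -mulrA vc mulr1.
Qed.

Lemma iso_phi_symmetric :
  bimod_iso phi -> symmetric_algebra (factor_algebra phi).
Proof.
move=> /bimod_iso_modulusP[v [cv _]].
apply: (twisted_trace_symmetric (d := 0) R_fd tw sk nu_c nu_comm _ (mulr1 1));
  first by [].
  by move=> s; rewrite mulr1 mul1r.
by right; exists v.
Qed.

Lemma symmetric_local :
  local_algebra R -> symmetric_algebra (factor_algebra phi) ->
  bimod_isomorphic (tpow (dual R) m) (regular R) \/ bimod_iso phi.
Proof.
move=> R_local /(symmetric_intertwiner R_fd tw sk nu_c)[w [wC wc0]].
have [p [q pq]] := bezout_of_annihilator R_fd tw wc0.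
have unit (a b v : R) : v * (a * b) = 1 -> exists u, a * u = 1 /\ u * a = 1.
  move=> /(fd_one_sided_inverse R_fd); rewrite -mulrA => ab.
  by exists (b * v); split=> //; apply: fd_one_sided_inverse.
have [[v /unit[u [wu uw]]]|[v /unit cu]] := local_sum_unit R_local pq.
  by left; apply/(tpow_regular_iso tw m R_fd); exists w, u.
by right; apply/bimod_iso_modulusP.
Qed.

Lemma symmetric_zero : c = 0 -> symmetric_algebra (factor_algebra phi) ->
  bimod_isomorphic (tpow (dual R) m) (regular R).
Proof.
move=> c0 /(symmetric_intertwiner R_fd tw sk nu_c)[w [wC wc0]].
have [s sw|v [wv vw]] := @fd_rreg_unit _ _ R_fd w.
  by apply: wc0; rewrite ?c0 ?mulr0.
by apply/(tpow_regular_iso tw m R_fd); exists w, v.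
Qed.

End SymmetryCriteria.

Theorem corollaryE (K : fieldType) (R : kalgType K) (n : nat)
    (phi : tpow (dual R) n -> regular R)
    (R_frobenius : frobenius_algebra R) (n_ge2 : (2 <= n)%N)
    (phi_hom : bimod_hom phi) (phi_assoc : associative_map phi) :
  (local_algebra R ->
     (symmetric_algebra (factor_algebra phi) <->
        bimod_isomorphic (tpow (dual R) (n - 2)%N) (regular R)
        \/ bimod_iso phi))
  /\
  (symmetric_algebra (zero_factor_algebra R n) <->
     bimod_isomorphic (tpow (dual R) (n - 2)%N) (regular R)).
Proof.
case: R_frobenius => R_fd /frobenius_twisted[lam [nu [psi tw]]].
case: n phi n_ge2 phi_hom phi_assoc => [|[|m]] // phi _ phi_hom phi_assoc.
have -> : (m.+2 - 2)%N = m by rewrite subn2.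
split=> [R_local|].
  split; first exact (symmetric_local R_fd tw phi_hom phi_assoc R_local).
  case; first exact (iso_power_symmetric R_fd tw phi_hom phi_assoc).
  exact (iso_phi_symmetric R_fd tw phi_hom phi_assoc).
have zero_hom : bimod_hom (fun _ : tpow (dual R) m.+2 => 0 : regular R).
  split=> [a y z|r y|y r]; first by rewrite scaler0 addr0.
    by rewrite (lin0 (lact_linear r)).
  by rewrite (lin0 (ract_linearl r)).
have zero_assoc : associative_map (fun _ : tpow (dual R) m.+2 => 0 : regular R).
  by move=> f; rewrite (lin0 (lact_linearl _)) (lin0 (ract_linear _)).
split; last exact (iso_power_symmetric R_fd tw zero_hom zero_assoc).
exact (symmetric_zero R_fd tw zero_hom zero_assoc (erefl _)).
Qed.
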